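(* Let $k,\ell,n$ be positive integers, let $\sigma\in S_n$ and let $(P,Q)$ be the pair of standard Young tableaux corresponding to $\sigma$ under the RSK correspondence. Then $\sigma$ is $(k,\ell)$-tricrucial if and only if all of the following hold: (1) the number of columns in $P$ (and $Q$) is $k-1$; (2) the number of rows in $P$ (and $Q$) is $\ell-1$; (3) $P$ contains an increasing sequence of elements $p_{1,k-1}<p_{2,j_2}<\cdots<p_{\ell-1,j_{\ell-1}}$ for some column indices $j_2,\ldots,j_{\ell-1}$; (4) $P$ contains an increasing sequence of elements $p_{\ell-1,1}<p_{i_2,2}<\cdots<p_{i_{k-1},k-1}$ for some row indices $i_2,\ldots,i_{k-1}$; (5) $Q$ contains an increasing sequence of elements $q_{1,k-1}<q_{2,j'_2}<\cdots<q_{\ell-1,j'_{\ell-1}}$ for some column indices $j'_2,\ldots,j'_{\ell-1}$.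
   Context: $S_n$ is the set of permutations $\sigma=\sigma_1\cdots\sigma_n$ of $\{1,\ldots,n\}$ in one-line notation. The patterns $12\cdots m$ and $m(m-1)\cdots 1$ are denoted $i_m$ and $d_m$; a permutation contains $i_m$ (resp. $d_m$) if it has an increasing (resp. decreasing) subsequence of length $m$, and avoids it otherwise. For $1\le t\le n+1$ put $e_t(x)=x$ if $x<t$ and $e_t(x)=x+1$ if $x\ge t$. The extensions of $\sigma\in S_n$ to the right are $e_t(\sigma_1)\cdots e_t(\sigma_n)\,t$, to the left are $t\,e_t(\sigma_1)\cdots e_t(\sigma_n)$, and from above are $\sigma_1\cdots\sigma_{t-1}(n+1)\sigma_t\cdots\sigma_n$, in each case for $1\le t\le n+1$. A permutation is $(k,\ell)$-tricrucial if it avoids $i_k$ and $d_\ell$ but each of its extensions to the right, to the left, and from above contains $i_k$ or $d_\ell$. RSK: $P$ is the insertion tableau obtained by row-inserting $\sigma_1,\ldots,\sigma_n$ successively into the empty tableau, and $Q$ is the recording tableau. $p_{i,j}$ and $q_{i,j}$ denote the entries of $P$ and $Q$ in row $i$ (from the top) and column $j$ (from the left). *)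

(* Defs.v *)
From mathcomp Require Import all_boot all_fingroup.

Set Implicit Arguments.
Unset Strict Implicit.
Unset Printing Implicit Defensive.

(* The point i : 'I_n stands for the integer i + 1 of {1, ..., n}, both as a
   position and as a value. *)
Definition one_line (n : nat) (sigma : 'S_n) : seq nat :=
  [seq (nat_of_ord (sigma i)).+1 | i <- enum 'I_n].

Definition contains_inc (m : nat) (w : seq nat) : Prop :=
  exists s : seq nat, [/\ subseq s w, size s = m & sorted ltn s].

Definition contains_dec (m : nat) (w : seq nat) : Prop :=
  exists s : seq nat, [/\ subseq s w, size s = m & sorted gtn s].

Definition shift (t x : nat) : nat := if x < t then x else x.+1.

Definition ext_right (t : nat) (w : seq nat) : seq nat :=
  rcons [seq shift t x | x <- w] t.

Definition ext_left (t : nat) (w : seq nat) : seq nat :=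
  t :: [seq shift t x | x <- w].

Definition ext_above (t : nat) (w : seq nat) : seq nat :=
  take t.-1 w ++ (size w).+1 :: drop t.-1 w.

Definition tricrucial (k l n : nat) (sigma : 'S_n) : Prop :=
  let w := one_line sigma in
  let hit v := contains_inc k v \/ contains_dec l v in
  [/\ ~ contains_inc k w,
      ~ contains_dec l w &
      forall t : nat, 1 <= t <= n.+1 ->
        [/\ hit (ext_right t w), hit (ext_left t w) & hit (ext_above t w)]].

(* A tableau is the list of its rows, from top to bottom. *)
Definition tableau := seq (seq nat).

(* Row insertion of x: the leftmost entry larger than x, if any, is replaced
   by x and returned; otherwise x is appended. *)
Fixpoint row_insert (x : nat) (r : seq nat) : seq nat * option nat :=
  if r is y :: r' then
    if x < y then (x :: r', Some y)
    else let: (r'', b) := row_insert x r' in (y :: r'', b)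
  else ([:: x], None).

(* Also returns the index, counted from 0, of the row that gains a cell. *)
Fixpoint insert (x : nat) (T : tableau) : tableau * nat :=
  if T is r :: T' then
    let: (r', b) := row_insert x r in
    if b is Some y then
      let: (T'', i) := insert y T' in (r' :: T'', i.+1)
    else (r' :: T', 0)
  else ([:: [:: x]], 0).

(* set_nth creates row i when it does not exist yet. *)
Definition add_cell (i x : nat) (T : tableau) : tableau :=
  set_nth [::] T i (rcons (nth [::] T i) x).

(* The pair (m, x) stands for the m-th insertion step, which inserts x. *)
Definition RSK_step (PQ : tableau * tableau) (mx : nat * nat)
    : tableau * tableau :=
  let: (P', i) := insert mx.2 PQ.1 in (P', add_cell i mx.1 PQ.2).

Definition RSK (n : nat) (sigma : 'S_n) : tableau * tableau :=
  let w := one_line sigma in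
  foldl RSK_step ([::], [::]) (zip (iota 1 (size w)) w).

Definition num_rows (T : tableau) : nat := size T.

Definition num_cols (T : tableau) : nat := \max_(r <- T) size r.

(* Rows and columns of cells and entries are numbered from 1. *)
Definition is_cell (T : tableau) (i j : nat) : bool :=
  [&& 1 <= i <= size T & 1 <= j <= size (nth [::] T i.-1)].

(* Meaningful only when is_cell T i j holds. *)
Definition entry (T : tableau) (i j : nat) : nat :=
  nth 0 (nth [::] T i.-1) j.-1.

(* Main.v *)
Require Import Defs.
From mathcomp Require Import all_boot all_fingroup.
From mathcomp Require Import zify.

(** Let w be the word of sigma, K = k - 1 and L = l - 1, and suppose that w has
    no increasing chain of K + 1 letters and no decreasing chain of L + 1 letters.
    A new letter t creates a forbidden chain exactly when it prolongs one of
    length K or L: on the right, t must exceed the last letter of an increasing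
    K-chain or be at most the last letter of a decreasing L-chain; the left is
    the mirror image; and from above, the new maximum at position t must follow
    an increasing K-chain or precede a decreasing L-chain ([hit_right],
    [hit_left], [hit_above]).  For all t at once, each condition compares two
    extremal chains, say the smallest end of an increasing K-chain with the
    largest end of a decreasing L-chain, and says that the thresholds leave no
    gap.

    Right and left extensions are read off P.  Row insertion changes
    the row reading word (rows from bottom to top) only by Knuth moves, and these
    preserve the lengths of monotone chains together with constraints of the form
    'all letters at least t' or 'all letters below t' ([bump_same_chains],
    [ins_same_chains]).  So w may be replaced by the reading word of P.  There a
    decreasing chain meets each row at most once and an increasing chain moves
    strictly rightwards through the columns.  Hence there are K columns and L
    rows, p_{1,K} is the smallest end of an increasing K-chain, p_{L,1} is the
    smallest head of a decreasing L-chain, and the chains whose end or head is as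
    large as possible are, up to their first entries, the two increasing sequences
    required of P ([right_criterion], [left_criterion]).

    The extension from above is read off Q without the symmetry between P
    and Q.  Let g be the word whose m-th letter is the index of the row that gains
    a cell at step m; its last 0 is at step q_{1,K}, the first step after which
    the prefix of w contains an increasing K-chain.  The condition becomes: the
    suffix of w starting at step q_{1,K} contains a decreasing L-chain.  Removing
    the first row replaces w by the word of the letters bumped from it, and
    shortens the longest decreasing chains by one ([chain_bumped],
    [bumped_chain]).  By induction on rows, the suffix contains a decreasing
    L-chain if and only if the corresponding suffix of g contains 0, 1, ..., L - 1
    as a subsequence ([gains_contains_dec], [contains_dec_gains]), which is the
    sequence required of Q ([recording_criterion]). *)

(** * Subsequences *)

Lemma subseq_catP (s a b : seq nat) :
  subseq s (a ++ b) ->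
  exists sa sb, [/\ s = sa ++ sb, subseq sa a & subseq sb b].
Proof.
case/subseqP=> m sz_m ->; rewrite -[m](cat_take_drop (size a)) mask_cat.
  by do 2!eexists; split; [reflexivity | exact: mask_subseq ..].
by rewrite size_takel // sz_m size_cat leq_addr.
Qed.

Lemma subseq1P (s : seq nat) x : subseq s [:: x] -> s = [::] \/ s = [:: x].
Proof.
case: s => [|a s]; first by left.
by rewrite /=; case: (a =P x) => // -> /eqP ->; right.
Qed.

Lemma subseq_index (s u : seq nat) :
  subseq s u ->
  exists c, [/\ sorted ltn c, all (gtn (size u)) c & s = [seq nth 0 u i | i <- c]].
Proof.
case/subseqP=> m sz_m ->; exists (mask m (iota 0 (size u))); split.
- exact/sorted_mask/iota_ltn_sorted/ltn_trans.
- by apply/allP => i /mem_mask; rewrite mem_iota.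
- by rewrite map_mask map_nth_iota0 // take_size.
Qed.

Lemma index_subseq (c u : seq nat) :
  sorted ltn c -> all (gtn (size u)) c -> subseq [seq nth 0 u i | i <- c] u.
Proof.
move=> c_s c_u; rewrite -{2}[u](mkseq_nth 0); apply: map_subseq.
have -> : c = [seq i <- iota 0 (size u) | i \in c].
  apply: (irr_sorted_eq ltn_trans ltnn) => //.
    exact/(sorted_filter ltn_trans)/iota_ltn_sorted.
  move=> i; rewrite mem_filter mem_iota /=; case ic: (i \in c) => //=.
  by have /= -> := allP c_u i ic.
exact: filter_subseq.
Qed.

(** Identifies the columns of an increasing chain that is as long as the first
    row of the tableau. *)
Lemma sorted_ltn_full (c : seq nat) q :
  sorted ltn c -> all (gtn q) c -> size c = q -> c = iota 0 q.
Proof.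
move=> c_s c_q sz; apply: (irr_sorted_eq ltn_trans ltnn) => //.
  exact: iota_ltn_sorted.
have c_u : uniq c by exact: (sorted_uniq ltn_trans ltnn).
case: (uniq_min_size c_u (s2 := iota 0 q)) => //.
  by move=> i /(allP c_q); rewrite mem_iota.
by rewrite size_iota sz.
Qed.

Lemma sorted_ltn_bound (c : seq nat) q :
  sorted ltn c -> all (gtn q) c -> size c <= q.
Proof.
move=> c_s c_q; rewrite -(size_iota 0 q); apply: uniq_leq_size.
  exact: (sorted_uniq ltn_trans ltnn).
by move=> i /(allP c_q); rewrite mem_iota.
Qed.

Lemma gtn_trans : transitive gtn.
Proof. by move=> y x z /= yx zy; exact: ltn_trans zy yx. Qed.

(** * Row insertion *)

Variant row_insert_spec x : seq nat -> seq nat * option nat -> Type :=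
  | RowAppend r of all (geq x) r : row_insert_spec x r (rcons r x, None)
  | RowBump r1 y r2 of all (geq x) r1 & x < y :
      row_insert_spec x (r1 ++ y :: r2) (r1 ++ x :: r2, Some y).

Lemma row_insertP x r : row_insert_spec x r (row_insert x r).
Proof.
elim: r => [|y r IH] /=; first exact: (@RowAppend x [::]).
case: ltnP => [xy|yx]; first exact: (@RowBump x [::]).
case: IH => [{}r r_x|r1 z r2 r1_x xz].
  by apply: (@RowAppend x (y :: r)); rewrite /= yx.
by apply: (@RowBump x (y :: r1)); rewrite //= yx.
Qed.

Lemma sorted_leq_cat (u v : seq nat) :
  sorted leq (u ++ v) =
  [&& sorted leq u, sorted leq v & all (fun a => all (leq a) v) u].
Proof.
by rewrite !(sorted_pairwise leq_trans) pairwise_cat /allrel andbC andbA.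
Qed.

Lemma sorted_leq_cons (y : nat) v :
  sorted leq (y :: v) = all (leq y) v && sorted leq v.
Proof. by rewrite !(sorted_pairwise leq_trans). Qed.

Lemma row_insert_sorted x r :
  sorted leq r -> sorted leq (row_insert x r).1.
Proof.
case: row_insertP => [{}r r_x|r1 y r2 r1_x xy] /=.
  by move=> r_s; rewrite -cats1 sorted_leq_cat r_s /=; apply: sub_all r_x => a /= ->.
rewrite !sorted_leq_cat !sorted_leq_cons /= => /and3P[-> /andP[y_r2 ->] r1_r2] /=.
rewrite andbT; apply/andP; split.
  by apply: sub_all y_r2 => a; apply: leq_trans; exact: ltnW.
apply/allP => a a_r1; have := allP r1_r2 a a_r1 => /= /andP[_ ->].
by rewrite andbT; exact: (allP r1_x).
Qed.

Definition ins (T : tableau) (x : nat) : tableau := (insert x T).1.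
Definition gain (T : tableau) (x : nat) : nat := (insert x T).2.

(** One step of insertion in a form that treats an empty tableau as one with an
    empty first row, so that inductions on rows need no separate base case. *)
Lemma ins_gainE T x :
  (ins T x, gain T x) =
  if row_insert x (head [::] T) is (r, Some y)
  then (r :: ins (behead T) y, (gain (behead T) y).+1)
  else (rcons (head [::] T) x :: behead T, 0).
Proof.
rewrite /ins /gain; case: T => [//|r T] /=.
by case: row_insertP => [//|r1 y r2 _ _]; case: insert.
Qed.

Lemma insE T x :
  ins T x = (row_insert x (head [::] T)).1 ::
    oapp (ins (behead T)) (behead T) (row_insert x (head [::] T)).2.
Proof.
have := ins_gainE T x; case: row_insertP => [r _|r1 y r2 _ _] [-> _] //.
Qed.

Lemma gainE T x :
  gain T x = oapp (fun y => (gain (behead T) y).+1) 0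
    (row_insert x (head [::] T)).2.
Proof.
have := ins_gainE T x; case: row_insertP => [r _|r1 y r2 _ _] [_ ->] //.
Qed.

Lemma head_sorted T : all (sorted leq) T -> sorted leq (head [::] T).
Proof. by case: T => //= r T /andP[]. Qed.

Lemma behead_sorted T : all (sorted leq) T -> all (sorted leq) (behead T).
Proof. by case: T => //= r T /andP[]. Qed.

Lemma ins_sorted T x : all (sorted leq) T -> all (sorted leq) (ins T x).
Proof.
elim: T x => [//|r T IH] x /= /andP[r_s T_s]; rewrite insE /= row_insert_sorted //=.
by case: (_.2) => //= y; exact: IH.
Qed.

(** * Knuth moves and monotone subsequences *)

(** The values of s' lie in the interval spanned by the values of s. This is what
    makes the relation stable under adding letters on both sides, and it carries
    any bound on the letters of s over to s'. *)
Definition squeezes (e : rel nat) (u v : seq nat) :=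
  forall s, subseq s u -> sorted e s ->
  exists s', [/\ subseq s' v, size s' = size s, sorted e s' &
    forall z, z \in s' ->
      (exists2 a, a \in s & a <= z) /\ (exists2 b, b \in s & z <= b)].

(** The consequences of Knuth equivalence of u and v that matter here. *)
Definition same_chains (u v : seq nat) :=
  [/\ squeezes ltn u v, squeezes ltn v u, squeezes gtn u v & squeezes gtn v u].

Lemma squeezes_refl e u : squeezes e u u.
Proof. by move=> s su se; exists s; split=> // z zs; split; exists z. Qed.

Lemma squeezes_trans e v u w : squeezes e u v -> squeezes e v w -> squeezes e u w.
Proof.
move=> uv vw s su se; have [s1 [s1v sz1 s1e hull1]] := uv s su se.
have [s2 [s2w sz2 s2e hull2]] := vw s1 s1v s1e.
exists s2; split; rewrite ?sz2 // => z /hull2[[a /hull1[[a' a's a'a] _] az]].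
case=> b /hull1[_ [b' b's bb']] zb; split.
  by exists a' => //; exact: leq_trans az.
by exists b' => //; exact: leq_trans bb'.
Qed.

(** A letter that extends the part of a chain inside u compares in the same way
    with every value between two letters of this part, by convexity of e. *)
Lemma squeezes_context (e : rel nat) a b u v :
    transitive e ->
    (forall p q z t, p <= z <= q -> e t p -> e t q -> e t z) ->
    (forall p q z t, p <= z <= q -> e p t -> e q t -> e z t) ->
  squeezes e u v -> squeezes e (a ++ u ++ b) (a ++ v ++ b).
Proof.
move=> tr cvl cvr uv s.
case/subseq_catP=> sa [sub [-> sa_a /subseq_catP[su [sb [-> su_u sb_b]]]]].
rewrite (sorted_pairwise tr) !pairwise_cat !allrel_catr.
case/and3P=> /andP[a_u a_b] e_a /and3P[u_b e_u e_b].
have [|s' [s'v sz s'e hull]] := uv su su_u; first by rewrite (sorted_pairwise tr).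
exists (sa ++ s' ++ sb); split.
- by rewrite !cat_subseq.
- by rewrite !size_cat sz.
- rewrite (sorted_pairwise tr) !pairwise_cat !allrel_catr a_b e_a e_b /= !andbT.
  rewrite -(sorted_pairwise tr) s'e andbT; apply/andP; split; apply/allrelP.
    move=> t z ta /hull[[p pu pz] [q qu zq]].
    by apply: (cvl p q); rewrite ?pz ?zq //; exact: (allrelP a_u).
  move=> z t /hull[[p pu pz] [q qu zq]] ta.
  by apply: (cvr p q); rewrite ?pz ?zq //; exact: (allrelP u_b).
- move=> z; rewrite !mem_cat => /or3P[za|/hull[[p pu pz] [q qu zq]]|zb].
  + by split; exists z; rewrite // !mem_cat za.
  + by split; [exists p | exists q]; rewrite // !mem_cat ?pu ?qu ?orbT.
  + by split; exists z; rewrite // !mem_cat zb !orbT.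
Qed.

Lemma same_chains_refl u : same_chains u u.
Proof. by split; exact: squeezes_refl. Qed.

Lemma same_chains_trans v u w :
  same_chains u v -> same_chains v w -> same_chains u w.
Proof.
by case=> ? ? ? ? [? ? ? ?]; split; apply: (@squeezes_trans _ v).
Qed.

Lemma same_chains_context a b u v :
  same_chains u v -> same_chains (a ++ u ++ b) (a ++ v ++ b).
Proof.
case=> uv1 vu1 uv2 vu2.
split; apply: squeezes_context => //; try exact: ltn_trans; try exact: gtn_trans;
  move=> p q z t /=; lia.
Qed.

Lemma sorted_gtn_row r s : sorted leq r -> subseq s r -> sorted gtn s -> size s <= 1.
Proof.
move=> r_s sr; have := subseq_sorted leq_trans sr r_s.
by case: s {sr} => [|a [|b s]] //= /andP[ab _] /andP[ba _]; lia.
Qed.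

(** Inserting x into the row r1 y r2 bumps y, and reading the new row after y is a
    sequence of Knuth moves. The two words differ by the places of x and y only,
    so a chain has to be changed only if it uses one of them in a way that the
    other word forbids; then exchanging x and y repairs it.
    A decreasing chain meets a sorted row at most once, so it has at most two
    letters here, and these can always be replaced by y, x. *)
Lemma bump_same_chains r1 y r2 x :
    sorted ltn (r1 ++ y :: r2) -> all (gtn x) r1 -> x < y ->
  same_chains (r1 ++ y :: r2 ++ [:: x]) (y :: r1 ++ x :: r2).
Proof.
move=> r_lt r1_x xy.
have r_s : sorted leq (r1 ++ y :: r2).
  by apply: sub_sorted r_lt => a b; exact: ltnW.
have r1_s : sorted ltn r1 by apply: (subseq_sorted ltn_trans) r_lt;
  exact: prefix_subseq.
have y_r2 : all (ltn y) r2.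
  move: r_lt; rewrite (sorted_pairwise ltn_trans) pairwise_cat.
  by case/and3P=> _ _ /=/andP[].
have r'_s : sorted ltn (r1 ++ x :: r2).
  move: r_lt; rewrite !(sorted_pairwise ltn_trans) !pairwise_cat !pairwise_cons.
  rewrite !allrel_consr => /and3P[/andP[_ ->] -> /andP[_ ->]] /=; rewrite !andbT.
  apply/andP; split; first by apply: sub_all r1_x.
  by apply: sub_all y_r2 => a /=; lia.
have r'_le : sorted leq (r1 ++ x :: r2).
  by apply: sub_sorted r'_s => a b; exact: ltnW.
split=> s.
(* Increasing chains of the old word: y becomes x, unless the chain starts at y. *)
- rewrite -cat1s; case/subseq_catP=> s1 [s' [-> s1r /subseq_catP[sy [s'' [-> sy_y]]]]].
  case/subseq_catP=> s2 [sx [-> s2r /subseq1P sx_x]] s_lt.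
  have s1_lt x0 : x0 \in s1 -> x0 < x by move/(mem_subseq s1r)/(allP r1_x).
  have s2_gt x0 : x0 \in s2 -> y < x0 by move/(mem_subseq s2r)/(allP y_r2).
  case: sx_x s_lt => ->; rewrite ?cats0 => s_lt; last first.
    case: s2 s2r s_lt s2_gt => [|z s2] s2r s_lt s2_gt; last first.
      move: s_lt; rewrite !(sorted_pairwise ltn_trans) catA pairwise_cat.
      case/and3P=> _ _; rewrite /= => /andP[]; rewrite all_cat => /and3P[_ /= zx _] _.
      by have := ltn_trans xy (ltn_trans (s2_gt z (mem_head _ _)) zx); rewrite ltnn.
    case/subseq1P: sy_y s_lt => -> s_lt; last first.
      move: s_lt; rewrite !(sorted_pairwise ltn_trans) pairwise_cat /=.
      by case/and3P=> _ _ /andP[]; rewrite andbT ltnNge (ltnW xy).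
    exists (s1 ++ [:: x]); split=> //; last by move=> z zs; split; exists z.
    apply: subseq_trans (subseq_cons _ _).
    by apply: cat_subseq => //; rewrite sub1seq mem_head.
  case/subseq1P: sy_y s_lt => ->; rewrite ?cat0s => s_lt.
    exists (s1 ++ s2); split=> //; last by move=> z zs; split; exists z.
    apply: subseq_trans (subseq_cons _ _); apply: cat_subseq => //.
    exact: subseq_trans s2r (subseq_cons _ _).
  case: s1 s1r s_lt s1_lt => [|p s1] s1r s_lt s1_lt.
    exists (y :: s2); split=> //; last by move=> z zs; split; exists z.
    rewrite /= eqxx -[s2]/([::] ++ s2); apply: cat_subseq; first exact: sub0seq.
    exact: subseq_trans s2r (subseq_cons _ _).
  exists ((p :: s1) ++ x :: s2); split=> //.
  + apply: subseq_trans (subseq_cons _ _); apply: cat_subseq => //.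
    by rewrite /= eqxx.
  + by rewrite !size_cat.
  + apply: (subseq_sorted ltn_trans) r'_s; apply: cat_subseq => //.
    by rewrite /= eqxx.
  + move=> z; rewrite mem_cat (in_cons x) => /or3P[zs|/eqP ->|zs].
    * by split; exists z => //; rewrite mem_cat zs.
    * split; [exists p | exists y]; rewrite ?(mem_cat, mem_head, orbT) //.
        by apply: ltnW; exact: s1_lt (mem_head _ _).
      exact: ltnW.
    * by split; exists z => //; rewrite !(mem_cat, in_cons) zs !orbT.
(* Increasing chains of the new word: x becomes y, unless the chain ends at x. *)
- rewrite -cat1s; case/subseq_catP=> sy [s' [-> sy_y /subseq_catP[s1 [s'' [-> s1r]]]]].
  rewrite -cat1s => /subseq_catP[sx [s2 [-> /subseq1P sx_x s2r]]] s_lt.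
  have s1_lt x0 : x0 \in s1 -> x0 < x by move/(mem_subseq s1r)/(allP r1_x).
  have s2_gt x0 : x0 \in s2 -> y < x0 by move/(mem_subseq s2r)/(allP y_r2).
  have r2_r : subseq r2 (r2 ++ [:: x]) by exact: prefix_subseq.
  case/subseq1P: sy_y s_lt => ->; rewrite ?cat0s => s_lt; last first.
    case: s1 s1r s_lt s1_lt => [|p s1] s1r /= s_lt s1_lt; last first.
      by case/andP: s_lt => /ltn_trans/(_ (s1_lt p (mem_head _ _)));
        rewrite ltnNge (ltnW xy).
    case: sx_x s_lt => ->; rewrite ?cat0s => s_lt; last first.
      by move: s_lt => /= /andP[]; rewrite ltnNge (ltnW xy).
    exists (y :: s2); split=> //; last by move=> z zs; split; exists z.
    rewrite -[y :: s2]/([::] ++ (y :: s2)); apply: cat_subseq; first exact: sub0seq.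
    by rewrite /= eqxx; exact: subseq_trans s2r r2_r.
  case: sx_x s_lt => ->; rewrite ?cat0s => s_lt.
    exists (s1 ++ s2); split=> //; last by move=> z zs; split; exists z.
    apply: cat_subseq => //; apply: subseq_trans s2r _.
    exact: subseq_trans r2_r (subseq_cons _ _).
  case: s2 s2r s_lt s2_gt => [|p s2] s2r s_lt s2_gt.
    exists (s1 ++ [:: x]); split=> //; last by move=> z zs; split; exists z.
    apply: cat_subseq => //; rewrite sub1seq in_cons mem_cat inE eqxx.
    by rewrite !orbT.
  exists (s1 ++ y :: p :: s2); split=> //.
  + apply: cat_subseq => //; rewrite [subseq _ _]/= eqxx.
    exact: subseq_trans s2r r2_r.
  + by rewrite !size_cat.
  + apply: (subseq_sorted ltn_trans) r_lt; apply: cat_subseq => //.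
    by rewrite [subseq _ _]/= eqxx.
  + move=> z; rewrite mem_cat (in_cons y) => /or3P[zs|/eqP ->|zs].
    * by split; exists z => //; rewrite mem_cat zs.
    * split; [exists x | exists p]; rewrite ?mem_cat ?inE ?eqxx ?orbT //.
        exact: ltnW.
      by apply: ltnW; exact: s2_gt (mem_head _ _).
    * by split; exists z => //; rewrite !mem_cat zs !orbT.
(* Decreasing chains: a chain p > x has y <= p, and a chain y > p has p <= x. *)
- rewrite -[y :: r2 ++ _]cat_cons catA =>
    /subseq_catP[s0 [sx [-> s0r /subseq1P sx_x]]] s_gt.
  have s0_gt : sorted gtn s0.
    by apply: (subseq_sorted gtn_trans) s_gt; exact: prefix_subseq.
  have := sorted_gtn_row _ _ r_s s0r s0_gt.
  case: s0 s0r s_gt {s0_gt} => [|p [|//]] s0r s_gt _.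
    exists sx; split=> //; last by move=> z zs; split; exists z.
    case: sx_x => ->; first exact: sub0seq.
    by rewrite sub1seq in_cons mem_cat mem_head !orbT.
  rewrite sub1seq in s0r.
  case: sx_x s_gt => ->; rewrite ?cats0 ?cat0s => s_gt.
    exists [:: p]; split=> //; last by move=> z zs; split; exists z.
    by move: s0r; rewrite sub1seq !(mem_cat, in_cons) => /or3P[] ->; rewrite ?orbT.
  exists [:: y; x]; split=> //.
  + by rewrite /= eqxx sub1seq mem_cat mem_head orbT.
  + by rewrite /= xy.
  + have yp : y <= p.
      move: s0r s_gt => +;
        rewrite mem_cat in_cons /= => /or3P[/(allP r1_x)|/eqP ->|/(allP y_r2)] //=;
          move: xy; clear; lia.
    move=> z; rewrite !inE => /orP[] /eqP->; split;
      by [exists x; rewrite // ?(ltnW xy) // !inE eqxx ?orbT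
         | exists p; rewrite // ?(leq_trans (ltnW xy) yp) // !inE eqxx].
- rewrite -cat1s; case/subseq_catP=> sy [s0 [-> /subseq1P sy_y s0r]] s_gt.
  have s0_gt : sorted gtn s0.
    by apply: (subseq_sorted gtn_trans) s_gt; exact: suffix_subseq.
  have := sorted_gtn_row _ _ r'_le s0r s0_gt.
  case: s0 s0r s_gt {s0_gt} => [|p [|//]] s0r s_gt _.
    rewrite cats0 in s_gt *; exists sy; split=> //; last by move=> z zs; split;
      exists z.
    case: sy_y => ->; first exact: sub0seq.
    by rewrite sub1seq mem_cat mem_head !orbT.
  rewrite sub1seq in s0r.
  case: sy_y s_gt => ->; rewrite ?cats0 ?cat0s => s_gt.
    exists [:: p]; split=> //; last by move=> z zs; split; exists z.
    by move: s0r; rewrite sub1seq !(mem_cat, in_cons) => /or3P[] ->; rewrite ?orbT.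
  exists [:: y; x]; split=> //.
  + rewrite -[[:: y; x]]/([::] ++ [:: y; x]); apply: cat_subseq; first exact: sub0seq.
    by rewrite /= eqxx sub1seq mem_cat mem_head orbT.
  + by rewrite /= xy.
  + have px : p <= x.
      move: s0r s_gt; rewrite mem_cat in_cons /= =>
        /or3P[/(allP r1_x)|/eqP ->|/(allP y_r2)] //=; move: xy; clear; lia.
    move=> z; rewrite !inE => /orP[] /eqP->; split;
      by [exists p; rewrite // ?(leq_trans px (ltnW xy)) // !inE eqxx ?orbT
         | exists y; rewrite // ?(ltnW xy) // !inE eqxx].
Qed.

Definition reading (T : tableau) : seq nat := flatten (rev T).

Lemma reading_cons r T : reading (r :: T) = reading T ++ r.
Proof. by rewrite /reading rev_cons flatten_rcons. Qed.

Lemma perm_ins T x : perm_eq (flatten (ins T x)) (x :: flatten T).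
Proof.
elim: T x => [|r T IH] x; rewrite insE //=; apply/seq.permP => p.
case: row_insertP => [{}r _|r1 y r2 _ _] /=.
  by rewrite -cats1 !count_cat /=; lia.
by rewrite !count_cat (seq.permP (IH y)) /=; lia.
Qed.

(** The rows below are read first, so after a bump the letter y stands right
    behind the reading word of the tableau into which it is inserted next. *)
Lemma ins_same_chains T x :
  all (sorted leq) T -> uniq (x :: flatten T) ->
  same_chains (reading T ++ [:: x]) (reading (ins T x)).
Proof.
elim: T x => [|r T IH] x; first by move=> _ _; exact: same_chains_refl.
move=> /= /andP[r_s T_s] /andP[x_rT]; rewrite cat_uniq => /and3P[r_u rT T_u].
rewrite insE /= !reading_cons.
case: row_insertP r_s r_u rT x_rT => [{}r _|r1 y r2 r1_x xy] r_s r_u rT x_rT /=.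
  by rewrite -cats1 -catA; exact: same_chains_refl.
have x_r1 : all (gtn x) r1.
  apply/allP => z zr1; have /= zx := allP r1_x z zr1.
  rewrite ltn_neqAle zx andbT; apply: contraNneq x_rT => <-.
  by rewrite !mem_cat zr1.
have r_lt : sorted ltn (r1 ++ y :: r2) by rewrite ltn_sorted_uniq_leq r_u.
have := same_chains_context (reading T) [::] _ _ (bump_same_chains _ _ _ _ r_lt x_r1 xy).
rewrite !cats0 -!catA /=; move/same_chains_trans; apply.
have := same_chains_context [::] (r1 ++ x :: r2) _ _ (IH y T_s _).
rewrite /= -!catA /=; apply; rewrite T_u andbT.
by apply: contra rT => yT; apply/hasP; exists y; rewrite // mem_cat mem_head orbT.
Qed.

Lemma perm_foldl_ins T w : perm_eq (flatten (foldl ins T w)) (flatten T ++ w).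
Proof.
elim: w T => [|x w IH] T /=; first by rewrite cats0.
apply: perm_trans (IH _) _; apply/seq.permP => q.
by rewrite !count_cat (seq.permP (perm_ins T x)) /=; lia.
Qed.

Lemma foldl_ins_same_chains T w :
  all (sorted leq) T -> uniq (flatten T ++ w) ->
  same_chains (reading T ++ w) (reading (foldl ins T w)).
Proof.
elim: w T => [|x w IH] T T_s Tw_u; first by rewrite cats0; exact: same_chains_refl.
have p : perm_eq (flatten (ins T x) ++ w) (flatten T ++ x :: w).
  by apply/seq.permP => q; rewrite !count_cat (seq.permP (perm_ins T x)) /=; lia.
have xT_u : uniq (x :: flatten T).
  rewrite /= -rcons_uniq -cats1; apply: subseq_uniq Tw_u.
  by apply: cat_subseq; rewrite //= eqxx sub0seq.
apply: same_chains_trans (IH _ (ins_sorted _ _ T_s) _); last by rewrite (perm_uniq p).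
have := same_chains_context [::] w _ _ (ins_same_chains T x T_s xT_u).
by rewrite /= -catA.
Qed.

(** * Standardness of the insertion tableau *)

Definition above (r s : seq nat) : bool :=
  (size s <= size r) && all (fun j => nth 0 r j < nth 0 s j) (iota 0 (size s)).

Lemma aboveP r s :
  reflect (size s <= size r /\ forall j, j < size s -> nth 0 r j < nth 0 s j)
          (above r s).
Proof.
apply: (iffP andP) => [[sz /allP rs]|[sz rs]]; split=> //.
  by move=> j js; apply: rs; rewrite mem_iota.
by apply/allP => j; rewrite mem_iota => /andP[_]; exact: rs.
Qed.

Lemma above_trans : transitive above.
Proof.
move=> s r t /aboveP[sr rs] /aboveP[ts st]; apply/aboveP.
split=> [|j jt]; first exact: leq_trans ts sr.
by apply: ltn_trans (st j jt); apply: rs; exact: leq_trans ts.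
Qed.

Definition is_tableau (T : tableau) : bool :=
  [&& all (sorted leq) T, [::] \notin T & sorted above T].

Lemma above_append r x s : above r s -> above (rcons r x) s.
Proof.
case/aboveP=> sz rs; apply/aboveP; rewrite size_rcons; split=> [|j js]; first lia.
by rewrite nth_rcons (leq_trans js sz); exact: rs.
Qed.

(** Columns stay strict: the entry of s below y is larger than y, so y enters s in
    a column weakly to the left of the one that it leaves, where the entries of
    the upper row are now at most x. *)
Lemma above_bump r1 x y r2 s :
    all (geq x) r1 -> x < y -> above (r1 ++ y :: r2) s ->
  above (r1 ++ x :: r2) (row_insert y s).1.
Proof.
move=> r1_x xy /aboveP[sz rs].
have le_r j : nth 0 (r1 ++ x :: r2) j <= nth 0 (r1 ++ y :: r2) j.
  rewrite !nth_cat; case: ltnP => // _; case: (j - size r1) => //=; lia.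
have lt_y j : j <= size r1 -> nth 0 (r1 ++ x :: r2) j < y.
  rewrite leq_eqVlt nth_cat => /orP[/eqP ->|jr]; first by rewrite ltnn subnn.
  rewrite jr; apply: leq_ltn_trans xy; exact: (allP r1_x _ (mem_nth 0 jr)).
have nth_y : nth 0 (r1 ++ y :: r2) (size r1) = y by rewrite nth_cat ltnn subnn.
have lt_s j : j < size s -> nth 0 (r1 ++ x :: r2) j < nth 0 s j.
  by move=> js; apply: leq_ltn_trans (le_r j) (rs j js).
move: sz rs lt_s; rewrite !size_cat /= => sz rs lt_s.
case: row_insertP sz rs lt_s => [{}s s_y|s1 z s2 s1_y yz] sz rs lt_s /=.
  have sr : size s <= size r1.
    rewrite leqNgt; apply/negP => lt; have := rs _ lt; rewrite nth_y.
    by have /= := allP s_y _ (mem_nth 0 lt); lia.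
  apply/aboveP; rewrite size_rcons size_cat /=; split=> [|j]; first lia.
  rewrite ltnS leq_eqVlt nth_rcons => /orP[/eqP ->|js].
    by rewrite ltnn eqxx; exact: lt_y.
  by rewrite js; exact: lt_s.
have sr : size s1 <= size r1.
  rewrite leqNgt; apply/negP => lt; have := rs (size r1).
  rewrite nth_y nth_cat lt size_cat => y_lt.
  by have /= := allP s1_y _ (mem_nth 0 lt); have := y_lt (ltn_addr _ lt); lia.
apply/aboveP; move: sz; rewrite !size_cat /= => sz; split=> [|j js]; first lia.
have [->|ne] := eqVneq j (size s1).
  by rewrite [X in _ < X]nth_cat ltnn subnn /=; exact: lt_y.
have := lt_s j; rewrite size_cat [nth 0 (s1 ++ z :: s2) j]nth_cat [nth 0 (s1 ++ y :: s2) j]nth_cat.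
move=> /(_ js); case: (ltnP j (size s1)) => // sj.
by have -> : j - size s1 = (j - size s1).-1.+1 by lia.
Qed.

Lemma path_sorted_head (T : tableau) r :
  path above r T = above r (head [::] T) && sorted above T.
Proof. by case: T => //=; rewrite andbT /above. Qed.

Lemma ins_tableau T x : is_tableau T -> is_tableau (ins T x).
Proof.
case/and3P=> T_s T_n T_a; rewrite /is_tableau ins_sorted //=.
elim: T x T_s T_n T_a => [//|r T IH] x /= /andP[_ T_s].
rewrite inE negb_or path_sorted_head => /andP[_ T_n] /andP[rT T_a].
rewrite insE /=; case: row_insertP rT => [{}r _|r1 y r2 r1_x xy] rT /=.
  rewrite inE negb_or T_n path_sorted_head above_append // T_a.
  by rewrite andbT eq_sym -size_eq0 size_rcons.
have /andP[insN insT] := IH y T_s T_n T_a.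
rewrite inE negb_or insN path_sorted_head insT insE /= above_bump //=.
by rewrite eq_sym -size_eq0 size_cat addnS.
Qed.

Lemma foldl_ins_tableau T w : is_tableau T -> is_tableau (foldl ins T w).
Proof. by elim: w T => //= x w IH T /(ins_tableau T x); exact: IH. Qed.

(** * Chains of the row reading word *)

Definition has_chain (e : rel nat) q (p : pred nat) (u : seq nat) :=
  exists s, [/\ subseq s u, size s = q, sorted e s & all p s].

Lemma all2_mem_nth (s : seq nat) (T : tableau) :
  all2 (fun z r => z \in r) s T =
  (size s == size T) && all (fun i => nth 0 s i \in nth [::] T i) (iota 0 (size T)).
Proof.
elim: T s => [|r T IH] [|z s] //=; rewrite IH eqSS -add1n iotaDl all_map.
by rewrite andbCA.
Qed.

Lemma dec_reading_size s T :
  all (sorted leq) T -> subseq s (reading T) -> sorted gtn s -> size s <= size T.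
Proof.
elim: T s => [|r T IH] s; first by move=> _; rewrite subseq0 => /eqP ->.
rewrite reading_cons => /= /andP[r_s T_s] /subseq_catP[s1 [s2 [-> s1T s2r]]] s_gt.
rewrite size_cat -addn1 leq_add //.
  by apply: IH => //; apply: (subseq_sorted gtn_trans) s_gt; exact: prefix_subseq.
apply: sorted_gtn_row r_s s2r _.
by apply: (subseq_sorted gtn_trans) s_gt; exact: suffix_subseq.
Qed.

Lemma dec_reading_full s T :
  all (sorted leq) T -> subseq s (reading T) -> sorted gtn s -> size s = size T ->
  all2 (fun z r => z \in r) (rev s) T.
Proof.
elim: T s => [|r T IH] s; first by move=> _; rewrite subseq0 => /eqP ->.
rewrite reading_cons => /= /andP[r_s T_s] /subseq_catP[s1 [s2 [-> s1T s2r]]] s_gt.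
have s1_gt : sorted gtn s1.
  by apply: (subseq_sorted gtn_trans) s_gt; exact: prefix_subseq.
have s2_gt : sorted gtn s2.
  by apply: (subseq_sorted gtn_trans) s_gt; exact: suffix_subseq.
rewrite size_cat; have := dec_reading_size _ _ T_s s1T s1_gt.
have := sorted_gtn_row _ _ r_s s2r s2_gt.
case: s2 s2r {s_gt s2_gt} => [|z [|//]] s2r /=; first lia.
move=> _ _; rewrite addn1 => -[sz]; rewrite rev_cat /= -sub1seq s2r.
exact: IH.
Qed.

Lemma reading_of_rows s T :
  all2 (fun z r => z \in r) s T -> subseq (rev s) (reading T).
Proof.
elim: T s => [|r T IH] [|z s] //= /andP[zr sT].
by rewrite rev_cons reading_cons -cats1 cat_subseq ?sub1seq ?IH.
Qed.

(** An increasing chain of the reading word moves strictly to the right: within a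
    row this is clear, and a step to a higher row weakly to the left would reach a
    smaller entry, because rows increase to the right and columns downwards. *)
Lemma inc_reading_cells s T :
  is_tableau T -> subseq s (reading T) -> sorted ltn s ->
  exists c, [/\ size c = size s, sorted ltn c &
    forall i, i < size s ->
      exists a, [/\ a < size T, nth 0 c i < size (nth [::] T a) &
                  nth 0 s i = nth 0 (nth [::] T a) (nth 0 c i)]].
Proof.
elim: T s => [|r T IH] s.
  by move=> _; rewrite subseq0 => /eqP -> _; exists [::].
case/and3P=> /= /andP[r_s T_s]; rewrite inE negb_or => /andP[_ T_n] T_a.
have {}IH s0 := IH s0 (introT and3P (And3 T_s T_n (path_sorted T_a))).
have r_T : all (above r) T by exact: (order_path_min above_trans).
rewrite reading_cons => /subseq_catP[s1 [s2 [-> s1T s2r]]].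
rewrite (sorted_pairwise ltn_trans) pairwise_cat -!(sorted_pairwise ltn_trans).
case/and3P=> s12 s1_lt s2_lt; have [c1 [sz1 c1_lt cell1]] := IH s1 s1T s1_lt.
have [c2 [c2_lt c2_r s2E]] := subseq_index _ _ s2r.
exists (c1 ++ c2); split.
- by rewrite !size_cat sz1 s2E size_map.
- rewrite (sorted_pairwise ltn_trans) pairwise_cat -!(sorted_pairwise ltn_trans).
  rewrite c1_lt c2_lt !andbT; apply/allrelP => p q /(nthP 0)[i i1 <-] qc2.
  rewrite sz1 in i1; have [a [aT ca sE]] := cell1 i i1.
  have lt_sq : nth 0 s1 i < nth 0 r q.
    apply: (allrelP s12); first exact: mem_nth.
    by rewrite s2E; apply/mapP; exists q.
  rewrite ltnNge; apply/negP => qc.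
  have /aboveP[sz ra] := allP r_T _ (mem_nth [::] aT).
  have := sorted_leq_nth leq_trans leqnn 0 r_s q (nth 0 c1 i).
  move/(_ (allP c2_r q qc2) (leq_trans ca sz) qc).
  by rewrite leqNgt (ltn_trans (ra _ ca)) // -sE.
- move=> i; rewrite size_cat !nth_cat sz1; case: (ltnP i (size s1)) => [i1 _|i1 i2].
    by have [a [aT ca sE]] := cell1 i i1; exists a.+1.
  have j2 : i - size s1 < size c2 by rewrite ltn_subLR // -(size_map (nth 0 r) c2) -s2E.
  exists 0; split=> //=; first exact: (allP c2_r _ (mem_nth 0 j2)).
  by rewrite s2E (nth_map 0).
Qed.

(** * The rows that gain a cell *)

Fixpoint gains (T : tableau) (w : seq nat) : seq nat :=
  if w is x :: w' then gain T x :: gains (ins T x) w' else [::].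

(** The word of the letters that the insertion of w pushes out of the first row
    r; it is the word inserted into the remaining rows. *)
Fixpoint bumped (r w : seq nat) : seq nat :=
  if w is x :: w' then
    let: (r', o) := row_insert x r in
    if o is Some y then y :: bumped r' w' else bumped r' w'
  else [::].

Lemma size_gains T w : size (gains T w) = size w.
Proof. by elim: w T => //= x w IH T; rewrite IH. Qed.

Lemma gains_cat T u v : gains T (u ++ v) = gains T u ++ gains (foldl ins T u) v.
Proof. by elim: u T => //= x u IH T; rewrite IH. Qed.

Lemma gains_bumped T w :
  [seq i.-1 | i <- gains T w & 0 < i] = gains (behead T) (bumped (head [::] T) w).
Proof.
elim: w T => //= x w IH T; rewrite gainE insE.
by case: row_insertP => [r _|r1 y r2 _ _] /=; rewrite IH.
Qed.

Lemma foldl_ins_bumped T w :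
  behead (foldl ins T w) = foldl ins (behead T) (bumped (head [::] T) w).
Proof.
elim: w T => //= x w IH T; rewrite IH insE.
by case: row_insertP.
Qed.

(** The steps that do not end in the first row are the steps of the bumped word
    in the remaining rows. *)
Lemma subseq_gains_bumped t T w :
  subseq [seq i.+1 | i <- t] (gains T w) =
  subseq t (gains (behead T) (bumped (head [::] T) w)).
Proof.
rewrite -gains_bumped; apply/idP/idP => [tT|].
  rewrite -[t](mapK succnK).
  apply: map_subseq; rewrite subseq_filter tT andbT.
  by apply/allP => _ /mapP[i _ ->].
move/(map_subseq succn); rewrite -map_comp; move/subseq_trans; apply.
rewrite map_id_in ?filter_subseq // => i.
by rewrite mem_filter => /andP[/prednK].
Qed.

Lemma path_gtn_le a b s : a <= b -> path gtn a s -> path gtn b s.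
Proof. by case: s => //= c s ab /andP[ca ->]; rewrite (leq_trans ca ab). Qed.

Lemma mem_row_insert x r : x \in (row_insert x r).1.
Proof.
by case: row_insertP => [r0 _|r1 y r2 _ _] /=;
  rewrite ?mem_rcons ?mem_cat mem_head ?orbT.
Qed.

(** A decreasing chain loses at most its first letter when the first row is
    removed. Between a letter v, once it is in the row, and the next letter u < v
    of the chain, something with a value in ]u, v] is bumped: either v itself
    leaves the row, or u finds it there and bumps an entry that is at most v.
    The two statements, for v already in the row and for v still to come, are
    proved together. *)
Lemma chain_bumped w r : sorted leq r ->
  (forall v c, v \in r -> subseq c w -> path gtn v c ->
    exists d, [/\ subseq d (bumped r w), size d = size c & path gtn v.+1 d]) /\
  (forall v c, subseq (v :: c) w -> path gtn v c ->
    exists d, [/\ subseq d (bumped r w), size d = size c & path gtn v.+1 d]).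
Proof.
elim: w r => [|x w IH] r r_s; first by split=> // v [|//] _ _ _; exists [::].
have r'_s := row_insert_sorted x r r_s.
have [IHrow IHword] := IH _ r'_s; split=> v c; last first.
  rewrite [subseq _ _]/=; case: eqP => [->|_] cw vc; last first.
    have [d [dw sz vd]] := IHword v c cw vc; exists d; split=> //=.
    by case: (row_insert x r) dw => r' [y|] dw //;
      exact: subseq_trans (subseq_cons _ _).
  have [d [dw sz vd]] := IHrow x c (mem_row_insert x r) cw vc.
  exists d; split=> //=.
  by case: (row_insert x r) dw => r' [y|] dw //; exact: subseq_trans (subseq_cons _ _).
move=> vr; case: c => [|u c]; first by exists [::]; rewrite sub0seq.
rewrite [subseq _ _]/= => cw /= /andP[uv uc]; move: cw.
have step d : subseq d (bumped (row_insert x r).1 w) -> subseq d (bumped r (x :: w)).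
  by rewrite /=; case: (row_insert x r) => r' [y|] dw //;
    exact: subseq_trans (subseq_cons _ _).
case: eqP => [ux|_] cw.
  subst u; move: r_s vr IHrow {step IHword IH r'_s}.
  case: row_insertP => [{}r r_x|r1 y r2 r1_x xy] r_s vr IHrow.
    by have /= := allP r_x v vr; rewrite leqNgt uv.
  have [|d [dw sz xd]] := IHrow x c _ cw uc; first by rewrite mem_cat mem_head orbT.
  exists (y :: d); split; rewrite /= ?eqxx ?sz //.
  rewrite (path_gtn_le _ _ _ xy xd) andbT ltnS.
  move: r_s vr; rewrite sorted_leq_cat mem_cat in_cons sorted_leq_cons.
  case/and3P=> _ /andP[y_r2 _] _ /or3P[/(allP r1_x) /=|/eqP->//|/(allP y_r2)//].
  by rewrite leqNgt uv.
have [vr'|vr'] := boolP (v \in (row_insert x r).1).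
  have [|d [dw sz vd]] := IHrow v (u :: c) vr' cw; first by rewrite /= uv.
  by exists d; split=> //; exact: step.
have [d [dw sz ud]] := IHword u c cw uc.
move: vr vr' dw {step IHrow IHword IH r'_s r_s}.
case: row_insertP => [{}r r_x|r1 y r2 r1_x xy] /= vr vr' dw.
  by rewrite mem_rcons in_cons vr orbT in vr'.
have -> : v = y.
  by move: vr vr'; rewrite !mem_cat !in_cons => /or3P[->|/eqP->|->]; rewrite ?orbT.
exists (y :: d); split; rewrite /= ?eqxx ?sz //.
have <- : v = y.
  by move: vr vr'; rewrite !mem_cat !in_cons => /or3P[->|/eqP->|->]; rewrite ?orbT.
by rewrite ltnSn (path_gtn_le _ _ _ uv ud).
Qed.

(** Conversely a decreasing chain y1 > y2 > ... of bumped letters lifts to w,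
    behind any earlier letter z that is at least y1. Let x be the letter that
    bumps y1. If y2 <= x, the lifted chain can continue with x and x takes the
    role of z. If x < y2 < y1, then y2 cannot be in the row at that moment, as x bumps the
    least entry larger than x; so y2 enters the row later and is itself an
    available letter, which makes up for the unused x. The second statement is
    this case: a chain whose head is not yet in the row even gains a letter. *)
Lemma bumped_chain w r : sorted leq r ->
  (forall z d, subseq d (bumped r w) -> path gtn z.+1 d ->
    exists c, [/\ subseq c w, size c = size d & path gtn z c]) /\
  (forall y d, y \notin r -> subseq (y :: d) (bumped r w) -> path gtn y d ->
    exists c, [/\ subseq (y :: c) w, size c = (size d).+1 & path gtn y c]).
Proof.
elim: w r => [|x w IH] r r_s.
  by split=> // z d; rewrite [bumped _ _]/= subseq0 => /eqP -> _; exists [::].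
have [] := IH _ (row_insert_sorted x r r_s); rewrite [bumped r (x :: w)]/=.
case: row_insertP r_s => [{}r r_x|r1 y r2 r1_x xy] r_s;
  cbv beta iota delta [fst] => IHlow IHnew.
  split=> [z d dw zd|y d yr dw yd].
    have [c [cw sz zc]] := IHlow z d dw zd.
    by exists c; split=> //; exact: subseq_trans (subseq_cons _ _).
  have [yx|yx] := eqVneq y x.
    subst x; have [|c [cw sz zc]] := IHlow y (y :: d) dw; first by rewrite /= ltnSn.
    by exists c; rewrite /= eqxx.
  have [|c [cw sz zc]] := IHnew y d _ dw yd.
    by rewrite mem_rcons in_cons negb_or yx.
  by exists c; rewrite /= (negPf yx).
move: r_s; rewrite sorted_leq_cat sorted_leq_cons => /and3P[_ /andP[y_r2 _] _].
split=> [z [|u d]|u d ur].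
- by move=> _ _; exists [::]; rewrite sub0seq.
- rewrite [subseq _ _]/=; case: eqP => [->|_] dw zd; last first.
    have [c [cw sz zc]] := IHlow z _ dw zd.
    by exists c; split=> //; exact: subseq_trans (subseq_cons _ _).
  have [yz {}zd] : y <= z /\ path gtn y d := andP zd; case: d dw zd => [|u' d] dw yd.
    by exists [:: x]; rewrite /= eqxx sub0seq (leq_trans xy yz).
  have [u'y u'd] : u' < y /\ path gtn u' d := andP yd; have [u'x|xu'] := leqP u' x.
    have [|c [cw sz xc]] := IHlow x (u' :: d) dw; first by rewrite /= ltnS u'x.
    by exists (x :: c); rewrite /= eqxx cw sz (leq_trans xy yz).
  have [|c [cw sz xc]] := IHnew u' d _ dw u'd.
    rewrite mem_cat in_cons !negb_or; apply/and3P; split.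
    + by apply/negP => /(allP r1_x) /=; rewrite leqNgt xu'.
    + by rewrite neq_ltn xu' orbT.
    + by apply/negP => /(allP y_r2); rewrite leqNgt u'y.
  exists (u' :: c); rewrite /= (leq_trans u'y yz) sz; split=> //.
  exact: subseq_trans cw (subseq_cons _ _).
- have uy : u != y by apply: contraNneq ur => ->; rewrite mem_cat mem_head orbT.
  rewrite [subseq _ _]/= (negPf uy) => dw ud.
  have [ux|ux] := eqVneq u x.
    subst x; have [|c [cw sz zc]] := IHlow u (u :: d) dw; first by rewrite /= ltnSn.
    by exists c; rewrite /= eqxx.
  have [|c [cw sz zc]] := IHnew u d _ dw ud.
    move: ur; rewrite !mem_cat !in_cons !negb_or => /and3P[-> _ ->].
    by rewrite ux.
  by exists c; rewrite /= (negPf ux).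
Qed.

(** The letter x that opens the staircase 0, 1, ... ends up as the largest entry of
    the first row. The chain of bumped letters given by induction either starts
    at or below x, and lifts behind x, or starts with a letter that is not in the row
    yet, and gains a letter by itself. *)
Lemma gains_contains_dec q T v :
  all (sorted leq) T -> subseq (iota 0 q) (gains T v) -> contains_dec q v.
Proof.
elim: q T v => [|q IHq] T v T_s; first by exists [::]; rewrite sub0seq.
elim: v T T_s => [//|x v IHv] T T_s.
rewrite [iota 0 _]/= [gains _ _]/= [subseq _ _]/=.
have [gain0 qT|_ qT] := eqVneq 0 (gain T x); last first.
  have [s [sv sz s_gt]] := IHv _ (ins_sorted T x T_s) qT.
  by exists s; split=> //; exact: subseq_trans (subseq_cons _ _).
move: qT gain0; rewrite (iotaDl 1 0 q) subseq_gains_bumped insE gainE /=.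
have := row_insert_sorted x _ (head_sorted _ T_s); have Tb_s := behead_sorted _ T_s.
case: row_insertP => [r r_x /= r_s qT _|//].
have [d [dv sz d_gt]] := IHq _ _ Tb_s qT.
have [low new] := bumped_chain v _ r_s.
case: d dv sz d_gt => [|y d] dv /= sz yd.
  by exists [:: x]; rewrite /= eqxx sub0seq -sz.
have [yx|xy] := leqP y x.
  have [|c [cv szc xc]] := low x (y :: d) dv; first by rewrite /= ltnS yx.
  by exists (x :: c); rewrite /= eqxx szc /= sz.
have [|c [cv szc yc]] := new y d _ dv yd.
  rewrite mem_rcons in_cons negb_or neq_ltn xy orbT /=.
  by apply/negP => /(allP r_x) /=; rewrite leqNgt xy.
exists (y :: c); split; rewrite // ?[size _]/= ?szc ?sz //.
exact: subseq_trans cv (subseq_cons _ _).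
Qed.

Lemma contains_dec_rows q T v :
  all (sorted leq) T -> contains_dec q v -> q <= size (foldl ins T v).
Proof.
elim: q T v => [//|q IHq] T v T_s [[|a c] [cv //= [sz] ac]].
have [_ word] := chain_bumped v _ (head_sorted _ T_s).
have [d [dv szd ad]] := word a c cv ac.
have : contains_dec q (bumped (head [::] T) v).
  by exists d; split; rewrite ?szd //; exact: path_sorted ad.
move/(IHq _ _ (behead_sorted _ T_s)); rewrite -foldl_ins_bumped size_behead.
case: v cv {word dv} => [//|x v] _ /=.
suff : 0 < size (foldl ins (ins T x) v) by case: size.
have : 0 < size (ins T x) by rewrite insE.
by elim: v (ins T x) => //= y v IH T' _; apply: IH; rewrite insE.
Qed.

(** The bound on the number of rows is used at every step: if the first letter of
    a longest decreasing chain bumped an entry, this entry would prolong the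
    chain of bumped letters and force one row too many. So it adds a cell to the
    first row, and the steps of the bumped chain all come later. *)
Lemma contains_dec_gains q T v :
  all (sorted leq) T -> contains_dec q v -> size (foldl ins T v) <= q ->
  subseq (iota 0 q) (gains T v).
Proof.
elim: q T v => [|q IHq] T v T_s; first by rewrite sub0seq.
elim: v T T_s => [|x v IHv] T T_s [[|a c] [cv //= [sz] ac]] q_rows.
have T'_s := ins_sorted T x T_s.
rewrite [subseq _ _]/= in cv; move: cv; case: eqP => [ax|_] cv; last first.
  have qT : subseq (iota 0 q.+1) (gains (ins T x) v).
    by apply: IHv => //; exists (a :: c); rewrite /= sz.
  by case: (0 == _); [exact: cons_subseq qT | exact: qT].
subst a; have [row _] := chain_bumped v _ (row_insert_sorted x _ (head_sorted _ T_s)).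
have [d [dv szd xd]] := row x c (mem_row_insert x _) cv ac.
have q_bumped : size (foldl ins (behead (ins T x)) (bumped (head [::] (ins T x)) v)) <= q.
  by rewrite -foldl_ins_bumped size_behead; move: q_rows; case: size.
suff gain0 : gain T x = 0.
  rewrite gain0 eqxx (iotaDl 1 0 q) subseq_gains_bumped; apply: IHq => //.
    exact: behead_sorted.
  exists d; rewrite insE szd; split=> //; exact: path_sorted xd.
move: q_bumped dv; rewrite gainE insE /=; case: row_insertP => [//|r1 y r2 _ xy /=].
move=> q_bumped dv; have :=
  contains_dec_rows q.+1 (behead T) (y :: bumped (r1 ++ x :: r2) v).
rewrite /= ltnNge q_bumped => /(_ (behead_sorted _ T_s)) absurd; exfalso.
have //: false; apply: absurd; exists (y :: d); rewrite /= eqxx dv szd sz; split=> //.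
exact: path_gtn_le xy xd.
Qed.

(** * Extremal chains of a tableau *)

Lemma nth_uniq_sorted T a :
  all (sorted leq) T -> uniq (flatten T) -> sorted ltn (nth [::] T a).
Proof.
elim: T a => [|r T IH] [|a] //= /andP[r_s T_s]; rewrite cat_uniq => /and3P[r_u _ T_u].
  by rewrite ltn_sorted_uniq_leq r_u.
exact: IH.
Qed.

Lemma rows_above T i j : is_tableau T -> i < j < size T -> above (nth [::] T i) (nth [::] T j).
Proof.
case/and3P=> _ _ T_a /andP[ij jT].
by apply: (sorted_ltn_nth above_trans [::] T_a) => //; exact: ltn_trans jT.
Qed.

Lemma column_le T i j b :
  is_tableau T -> i <= j -> b < size (nth [::] T j) ->
  b < size (nth [::] T i) /\ nth 0 (nth [::] T i) b <= nth 0 (nth [::] T j) b.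
Proof.
move=> tabT; rewrite leq_eqVlt => /predU1P[-> //|ij bj].
have [jT|Tj] := ltnP j (size T); last by rewrite nth_default in bj.
have /aboveP[sz lt_ij] := rows_above T i j tabT (introT andP (conj ij jT)).
by rewrite (leq_trans bj sz) ltnW // lt_ij.
Qed.

Lemma head_reading T : subseq (head [::] T) (reading T).
Proof. by case: T => //= r T; rewrite reading_cons suffix_subseq. Qed.

Lemma inc_columns s T :
  is_tableau T -> subseq s (reading T) -> sorted ltn s ->
  size s <= size (head [::] T).
Proof.
move=> tabT sT s_lt; have [c [sz c_lt cells]] := inc_reading_cells s T tabT sT s_lt.
rewrite -sz; apply: sorted_ltn_bound => //; apply/(all_nthP 0) => i; rewrite sz => si.
have [a [_ ca _]] := cells i si; rewrite -nth0.
by have [] := column_le T 0 a _ tabT (leq0n a) ca.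
Qed.

Lemma sorted_ltn_ge (c : seq nat) i : sorted ltn c -> i < size c -> i <= nth 0 c i.
Proof.
move=> c_lt; elim: i => // i IH ic; apply: leq_ltn_trans (IH (ltnW ic)) _.
by apply: (sorted_ltn_nth ltn_trans 0 c_lt) => //; exact: ltnW.
Qed.

(** Schensted: the (q + 1)-st letter of an increasing chain sits in a column of
    index at least q, so its value is at least the entry of the first row in
    column q. *)
Lemma min_inc_end T t q :
  is_tableau T -> uniq (flatten T) ->
  has_chain ltn q.+1 (gtn t) (reading T) <->
  q < size (head [::] T) /\ entry T 1 q.+1 < t.
Proof.
move=> tabT T_u; rewrite /entry /= nth0; split.
  case=> s [sT sz s_lt s_t]; rewrite -sz; split; first exact: inc_columns.
  have [c [szc c_lt cells]] := inc_reading_cells s T tabT sT s_lt.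
  have [|a [aT ca sE]] := cells q; first by rewrite sz.
  have qc : q <= nth 0 c q by apply: sorted_ltn_ge; rewrite ?szc ?sz.
  have qs : q < size s by rewrite sz.
  apply: leq_ltn_trans (allP s_t _ (mem_nth 0 qs)).
  rewrite sE; have qa := leq_ltn_trans qc ca.
  rewrite -nth0; apply: leq_trans (column_le T 0 a q tabT (leq0n a) qa).2 _.
  have a_s : sorted leq (nth [::] T a) by case/and3P: tabT => /all_nthP->.
  exact: (sorted_leq_nth leq_trans leqnn 0 a_s).
case=> qT lt_t; have T_s : all (sorted leq) T by case/and3P: tabT.
have r_lt : sorted ltn (head [::] T) by rewrite -nth0; exact: nth_uniq_sorted.
exists (take q.+1 (head [::] T)); split.
- exact: subseq_trans (take_subseq _ _) (head_reading T).
- by rewrite size_takel.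
- exact: take_sorted.
- apply/(all_nthP 0) => i; rewrite size_takel // ltnS => iq; rewrite nth_take //=.
  apply: leq_ltn_trans lt_t;
    apply: (sorted_leq_nth leq_trans leqnn 0 (head_sorted T T_s)) => //.
  exact: leq_ltn_trans qT.
Qed.

(** A decreasing chain with one letter in each row starts in the bottom row; the
    first column is such a chain, with the smallest possible head. *)
Lemma min_dec_head T t q :
  is_tableau T -> size T = q.+1 ->
  has_chain gtn q.+1 (gtn t) (reading T) <-> entry T q.+1 1 < t.
Proof.
move=> tabT szT; have [T_s T_n T_a] := and3P tabT; rewrite /entry /=; split.
  case=> s [sT sz s_gt s_t]; have := dec_reading_full s T T_s sT s_gt.
  rewrite sz szT => /(_ erefl); rewrite all2_mem_nth => /andP[/eqP szs /allP sTi].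
  have := sTi q; rewrite szT mem_iota => /(_ (ltnSn q)) qT.
  have qs : nth 0 (rev s) q \in s.
    by rewrite -mem_rev; apply: mem_nth; rewrite szs szT.
  apply: leq_ltn_trans (allP s_t _ qs); move: qT.
  have : sorted leq (nth [::] T q) by apply: (all_nthP [::] T_s); rewrite szT.
  case: (nth [::] T q) => [//|x r] /=; rewrite (path_sortedE leq_trans) => /andP[x_r _].
  by rewrite in_cons => /predU1P[->|/(allP x_r)].
move=> lt_t; set u := [seq nth 0 r 0 | r <- T].
have u_lt : sorted ltn u.
  rewrite sorted_map; apply: (sub_in_sorted (P := mem T)) T_a; last exact/allP.
  move=> r s /= _ sT /aboveP[_]; apply; rewrite lt0n size_eq0.
  by apply: contraNneq T_n => <-.
exists (rev u); split.
- apply: reading_of_rows; rewrite all2_mem_nth size_map eqxx /=.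
  apply/allP => i; rewrite mem_iota => /= iT; rewrite (nth_map [::]) //.
  apply: mem_nth; rewrite lt0n size_eq0; apply: contraNneq T_n => <-.
  exact: mem_nth.
- by rewrite size_rev size_map.
- by rewrite rev_sorted.
- rewrite all_rev; apply/(all_nthP 0) => i iu /=; apply: leq_ltn_trans lt_t.
  have -> : nth 0 (nth [::] T q) 0 = nth 0 u q by rewrite (nth_map [::]) // szT.
  have u_le : sorted leq u by apply: sub_sorted u_lt => x y; exact: ltnW.
  apply: (sorted_leq_nth leq_trans leqnn 0 u_le) => //.
    by rewrite inE size_map szT.
  by move: iu; rewrite size_map szT.
Qed.

(** A decreasing chain as long as the number of rows takes one letter from each
    row, and read from top to bottom it is an increasing sequence of entries. *)
Lemma max_dec_end T t :
  is_tableau T -> 0 < size T ->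
  has_chain gtn (size T) (leq t) (reading T) <->
  exists j : nat -> nat,
    [/\ t <= entry T 1 (j 1),
        forall i, 1 <= i <= size T -> is_cell T i (j i) &
        forall i, 1 <= i < size T -> entry T i (j i) < entry T i.+1 (j i.+1)].
Proof.
move=> tabT T_gt0; have [T_s T_n T_a] := and3P tabT; split.
  case=> s [sT sz s_gt s_t]; have := dec_reading_full s T T_s sT s_gt sz.
  rewrite all2_mem_nth => /andP[/eqP szs /allP sTi].
  pose u := rev s; have u_lt : sorted ltn u by rewrite rev_sorted.
  have {sTi}uT i : 1 <= i <= size T -> nth 0 u i.-1 \in nth [::] T i.-1.
    by case: i => //= i iT; apply: sTi; rewrite mem_iota.
  pose j i := (index (nth 0 u i.-1) (nth [::] T i.-1)).+1.
  have jE i : 1 <= i <= size T -> entry T i (j i) = nth 0 u i.-1.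
    by move/uT => iT; rewrite /entry /j /= nth_index.
  exists j; split.
  - rewrite jE ?T_gt0 //; apply: (allP s_t); rewrite -mem_rev; apply: mem_nth.
    by rewrite szs.
  - by move=> i iT; rewrite /is_cell iT /j /= index_mem uT.
  - move=> i /andP[i1 iT]; rewrite !jE ?i1 ?(ltnW iT) //.
    case: i i1 iT => //= i _ iT.
    by apply: (sorted_ltn_nth ltn_trans 0 u_lt); rewrite ?inE ?szs // ltnW.
case=> j [t_j cell_j lt_j]; pose u := mkseq (fun i => entry T i.+1 (j i.+1)) (size T).
have u_lt : sorted ltn u.
  by apply/(sortedP 0) => i; rewrite size_mkseq => iT;
    rewrite !nth_mkseq ?(ltnW iT) //; exact: lt_j.
have u_le : sorted leq u by apply: sub_sorted u_lt => x y; exact: ltnW.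
exists (rev u); split.
- apply: reading_of_rows; rewrite all2_mem_nth size_mkseq eqxx /=.
  apply/allP => i; rewrite mem_iota => /= iT; rewrite nth_mkseq // /entry /=.
  have /and3P[_ /= j1 jT] := cell_j i.+1 iT.
  by apply: mem_nth; case: (j i.+1) j1 jT.
- by rewrite size_rev size_mkseq.
- by rewrite rev_sorted.
- rewrite all_rev; apply/(all_nthP 0) => i iu /=; apply: leq_trans t_j _.
  have -> : entry T 1 (j 1) = nth 0 u 0 by rewrite nth_mkseq.
  by apply: (sorted_leq_nth leq_trans leqnn 0 u_le) => //; rewrite inE size_mkseq.
Qed.

Lemma reading_take a T :
  a < size T -> reading (take a.+1 T) = nth [::] T a ++ reading (take a T).
Proof. by move=> aT; rewrite /reading (take_nth [::] aT) rev_rcons. Qed.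

Lemma reading_take_subseq a b T :
  a <= b -> subseq (reading (take a T)) (reading (take b T)).
Proof.
move=> ab; rewrite -(take_takel T ab) -{2}[take b T](cat_take_drop a) /reading.
by rewrite rev_cat flatten_cat; exact: suffix_subseq.
Qed.

(** An increasing sequence with one entry in each column need not follow the
    reading order, as it may step down. Working from the right, an entry that is
    higher than its successor is replaced by the entry of its column in the
    successor's row: it grows, but stays below its right neighbour, and the
    resulting sequence never steps down. *)
Lemma columns_reading T (f : nat -> nat) K :
    is_tableau T -> uniq (flatten T) ->
    (forall b, b < K -> b < size (nth [::] T (f b))) ->
    (forall b, b.+1 < K ->
      nth 0 (nth [::] T (f b)) b < nth 0 (nth [::] T (f b.+1)) b.+1) ->
  forall q b, b + q.+1 = K ->
  exists a s, [/\ b < size (nth [::] T a),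
    subseq s (drop b.+1 (nth [::] T a) ++ reading (take a T)),
    size s = q,
    path ltn (nth 0 (nth [::] T a) b) s &
    nth 0 (nth [::] T (f b)) b <= nth 0 (nth [::] T a) b].
Proof.
move=> tabT T_u f_cell f_lt; have T_s : all (sorted leq) T by case/and3P: tabT.
elim=> [|q IHq] b bq.
  by exists (f b), [::]; rewrite sub0seq f_cell // -bq addn1.
have [|a [s [ba sT sz s_lt fa]]] := IHq b.+1; first by rewrite -bq addSnnS.
have fb_lt : nth 0 (nth [::] T (f b)) b < nth 0 (nth [::] T a) b.+1.
  by apply: leq_trans (f_lt b _) fa; rewrite -bq addnS ltnS addnS ltnS leq_addr.
have aT : a < size T by rewrite ltnNge; apply/negP => Ta; rewrite nth_default in ba.
have s'T : subseq (nth 0 (nth [::] T a) b.+1 :: s) (drop b.+1 (nth [::] T a) ++ reading (take a T)).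
  by rewrite (drop_nth 0 ba) /= eqxx.
have [fba|afb] := leqP (f b) a.
  exists a, (nth 0 (nth [::] T a) b.+1 :: s); split=> //=.
  - exact: ltnW.
  - by rewrite sz.
  - rewrite s_lt andbT; apply: (sorted_ltn_nth ltn_trans 0 (nth_uniq_sorted T a T_s T_u)) => //.
    exact: ltnW.
  - by have [] := column_le T (f b) a b tabT fba (ltnW ba).
exists (f b), (nth 0 (nth [::] T a) b.+1 :: s); split=> //=.
- by apply: f_cell; rewrite -bq -addSnnS leq_addr.
- apply: subseq_trans s'T _; apply: subseq_trans (suffix_subseq _ _).
  apply: subseq_trans (reading_take_subseq _ _ _ afb); rewrite reading_take //.
  by apply: cat_subseq => //; exact: drop_subseq.
- by rewrite sz.
- by rewrite fb_lt.
Qed.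

(** A longest increasing chain of the reading word visits each column once, and
    [columns_reading] turns such a sequence of entries back into a chain whose
    head has not decreased. *)
Lemma max_inc_head T t :
  is_tableau T -> uniq (flatten T) -> 0 < size (head [::] T) ->
  has_chain ltn (size (head [::] T)) (leq t) (reading T) <->
  exists i : nat -> nat,
    [/\ t <= entry T (i 1) 1,
        forall j, 1 <= j <= size (head [::] T) -> is_cell T (i j) j &
        forall j, 1 <= j < size (head [::] T) ->
          entry T (i j) j < entry T (i j.+1) j.+1].
Proof.
move=> tabT T_u K_gt0; set K := size _ in K_gt0 *; split.
  case=> s [sT sz s_lt s_t].
  have [c [szc c_lt cells]] := inc_reading_cells s T tabT sT s_lt.
  have cE : c = iota 0 K.
    apply: sorted_ltn_full; rewrite ?szc //; apply/(all_nthP 0) => i; rewrite szc => si.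
    have [a [_ ca _]] := cells i si; rewrite /K -nth0.
    by have [] := column_le T 0 a _ tabT (leq0n a) ca.
  pose at_col b (r : seq nat) := (b < size r) && (nth 0 r b == nth 0 s b).
  have has_col b : b < K -> has (at_col b) T.
    move=> bK; have [|a [aT]] := cells b; first by rewrite sz.
    rewrite cE nth_iota // add0n => ba sE; apply/(has_nthP [::]).
    by exists a; rewrite // /at_col ba sE eqxx.
  pose i j := (find (at_col j.-1) T).+1.
  have iE j : 1 <= j <= K -> is_cell T (i j) j /\ entry T (i j) j = nth 0 s j.-1.
    case: j => //= j jK; have jT := has_col j jK.
    have /andP[sz_j /eqP nth_j] := nth_find [::] jT.
    by rewrite /is_cell /entry /i /= -has_find jT sz_j.
  exists i; split.
  - by rewrite (iE 1 _).2 ?K_gt0 //; apply: (allP s_t); apply: mem_nth; rewrite sz.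
  - by move=> j /iE[].
  - move=> j /andP[j1 jK]; rewrite (iE j _).2 ?(iE j.+1 _).2 ?j1 ?(ltnW jK) //.
    by case: j j1 jK => //= j _ jK; apply: (sorted_ltn_nth ltn_trans 0 s_lt);
      rewrite ?inE ?sz // ltnW.
case=> i [t_i cell_i lt_i]; pose f b := (i b.+1).-1.
have [|||a [s [aT sT sz s_lt fa]]] := columns_reading T f K tabT T_u _ _ K.-1 0.
- by move=> b bK; have /and3P[] := cell_i b.+1 bK.
- by move=> b bK; exact: (lt_i b.+1 bK).
- by rewrite add0n prednK.
set x := nth 0 (nth [::] T a) 0 in s_lt fa; exists (x :: s); split=> //.
- have aT' : a < size T by rewrite ltnNge; apply/negP => Ta; rewrite nth_default in aT.
  apply: (@subseq_trans _ (reading (take a.+1 T))).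
    by rewrite reading_take // -[nth [::] T a]drop0 (drop_nth 0 aT) /= eqxx.
  by rewrite -{2}[T]take_size; exact: reading_take_subseq.
- by rewrite /= sz prednK.
- have t_x : t <= x by exact: leq_trans t_i fa.
  rewrite /= t_x /=; move: s_lt; rewrite (path_sortedE ltn_trans) => /andP[x_s _].
  by apply: sub_all x_s => y /ltnW; exact: leq_trans.
Qed.

(** * The recording tableau *)

Definition record (Q : tableau) (ti : nat * nat) : tableau := add_cell ti.2 ti.1 Q.

Lemma foldl_RSK_step P Q m w :
  foldl RSK_step (P, Q) (zip (iota m (size w)) w) =
  (foldl ins P w, foldl record Q (zip (iota m (size w)) (gains P w))).
Proof.
elim: w P Q m => //= x w IH P Q m; rewrite -IH /RSK_step /ins /gain /record /=.
by case: insert.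
Qed.

Lemma RSKE n (sigma : 'S_n) (w := one_line sigma) :
  RSK sigma = (foldl ins [::] w,
               foldl record [::] (zip (iota 1 (size w)) (gains [::] w))).
Proof. exact: foldl_RSK_step. Qed.

Lemma row_foldl_record Q tis i :
  nth [::] (foldl record Q tis) i =
  nth [::] Q i ++ [seq ti.1 | ti <- tis & ti.2 == i].
Proof.
elim: tis Q => [|[t j] tis IH] Q /=; first by rewrite cats0.
rewrite IH /record /add_cell /= nth_set_nth /= [i == j]eq_sym.
by case: eqP => [->|_] //=; rewrite cat_rcons.
Qed.

Lemma row_record g i :
  nth [::] (foldl record [::] (zip (iota 1 (size g)) g)) i =
  [seq t <- iota 1 (size g) | nth 0 g t.-1 == i].
Proof.
rewrite row_foldl_record nth_nil /=; set tis := zip _ _.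
have -> : tis = [seq (t, nth 0 g t.-1) | t <- iota 1 (size g)].
  have sz : size (iota 1 (size g)) = size g by rewrite size_iota.
  apply: (@eq_from_nth _ (0, 0)) => [|k]; first by rewrite size_map size_zip sz minnn.
  rewrite size_zip sz minnn => kg; rewrite nth_zip // (nth_map 0) ?size_iota //.
  by rewrite nth_iota.
by rewrite filter_map -map_comp map_id.
Qed.

Lemma shape_ins T x : shape (ins T x) = incr_nth (shape T) (gain T x).
Proof.
elim: T x => [//|r T IH] x; rewrite insE gainE /=.
case: row_insertP => [{}r _|r1 y r2 _ _] /=; first by rewrite size_rcons.
by rewrite -IH /shape !size_cat.
Qed.

Lemma shape_record Q ti : shape (record Q ti) = incr_nth (shape Q) ti.2.
Proof.
case: ti => t i; rewrite /record /add_cell /=.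
elim: Q i => [|r Q IH] [|i] //=; rewrite ?size_rcons -?IH //.
by congr cons; elim: i => //= i ->.
Qed.

Lemma shape_foldl_record P Q m w :
  shape P = shape Q ->
  shape (foldl record Q (zip (iota m (size w)) (gains P w))) = shape (foldl ins P w).
Proof.
elim: w P Q m => //= x w IH P Q m PQ; apply: IH.
by rewrite shape_ins shape_record PQ.
Qed.

Lemma size_row_foldl_ins T w i :
  size (nth [::] (foldl ins T w) i) = size (nth [::] T i) + count_mem i (gains T w).
Proof.
have sizeE U : size (nth [::] U i) = nth 0 (shape U) i.
  have [iU|Ui] := ltnP i (size U); first by rewrite (nth_map [::]).
  by rewrite !nth_default // size_map.
elim: w T => [|x w IH] T /=; first by rewrite addn0.
by rewrite IH !sizeE shape_ins nth_incr_nth -addnA addnCA.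
Qed.

Lemma num_colsE T : is_tableau T -> num_cols T = size (head [::] T).
Proof.
move=> tabT; rewrite /num_cols; apply/eqP; rewrite eqn_leq; apply/andP; split.
  apply/bigmax_leqP_seq => r /(nthP [::])[a _ <-] _; rewrite -nth0.
  case: (posnP (size (nth [::] T a))) => [-> //|a_gt0].
  rewrite -(prednK a_gt0); apply: (column_le T 0 a _ tabT (leq0n a) _).1.
  by rewrite prednK.
case: T {tabT} => [//|r T] /=; rewrite big_cons; exact: leq_maxl.
Qed.

Lemma shape_num_cols T U : shape T = shape U -> num_cols T = num_cols U.
Proof.
by move=> TU; rewrite /num_cols -!(big_map size xpredT id) -/(shape T) TU.
Qed.

(** * Crucial extensions *)

Lemma has_chainT e q w :
  has_chain e q predT w <-> exists s, [/\ subseq s w, size s = q & sorted e s].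
Proof.
split=> [[s [sw sz s_e _]]|[s [sw sz s_e]]]; exists s; split=> //; exact: all_predT.
Qed.

(** A chain that is too long for u ++ v must use the new letter t, which splits it
    into a part in u and a part in v. The map f renumbers the old letters. *)
Lemma pivot_chain (e : rel nat) f q t u v :
    {mono f : x y / e x y} ->
    ~ has_chain e q.+1 predT (u ++ v) ->
  has_chain e q.+1 predT (map f u ++ t :: map f v) <->
  exists su sv, [/\ subseq su u, subseq sv v, size su + size sv = q &
    sorted e (map f su ++ t :: map f sv)].
Proof.
move=> f_mono no; split; last first.
  case=> su [sv [suu svv sz e_s]]; exists (map f su ++ t :: map f sv); split=> //.
  - by apply: cat_subseq; rewrite /= ?eqxx; exact: map_subseq.
  - by rewrite size_cat /= !size_map addnS sz.
  - exact: all_predT.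
case=> s [] /subseq_catP[s1 [s2 [-> s1u]]].
have map_mask (x : seq nat) y : subseq x (map f y) -> exists2 z, subseq z y & x = map f z.
  by case/subseqP=> m _ ->; exists (mask m y); rewrite ?mask_subseq ?map_mask.
case: (map_mask _ _ s1u) => su suu ->.
case: s2 => [|x s2].
  move=> _ sz e_s _; case: no; exists su; split=> //.
  - exact: subseq_trans (prefix_subseq _ _).
  - by rewrite -sz cats0 size_map.
  - by move: e_s; rewrite cats0 sorted_map; apply: sub_sorted => a b /=; rewrite f_mono.
  - exact: all_predT.
rewrite [subseq _ _]/=; case: eqP => [->|_] s2v sz e_s _.
  have [sv svv s2E] := map_mask _ _ s2v; exists su, sv; split=> //;
    last by rewrite -s2E.
  by move: sz; rewrite s2E size_cat /= !size_map; lia.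
have [sv svv s2E] := map_mask _ _ s2v; case: no; exists (su ++ sv); split=> //.
- exact: cat_subseq.
- by rewrite -sz s2E !size_cat !size_map.
- move: e_s; rewrite s2E -map_cat sorted_map.
  by apply: sub_sorted => a b /=; rewrite f_mono.
- exact: all_predT.
Qed.

Lemma shift_ltn t : {mono shift t : x y / ltn x y}.
Proof. by move=> x y; rewrite /shift /=; case: ifP; case: ifP; lia. Qed.

Lemma shift_gtn t : {mono shift t : x y / gtn x y}.
Proof. by move=> x y; exact: (shift_ltn t y x). Qed.

Lemma sorted_rcons_map (e : rel nat) f t s :
    transitive e -> {mono f : x y / e x y} ->
  sorted e (map f s ++ [:: t]) = sorted e s && all (fun x => e (f x) t) s.
Proof.
move=> tr f_mono; rewrite !(sorted_pairwise tr) pairwise_cat allrel_consr allrel0r /=.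
rewrite !andbT all_map pairwise_map andbC; congr (_ && _).
by apply: eq_pairwise => x y /=; rewrite f_mono.
Qed.

Lemma sorted_cons_map (e : rel nat) f t s :
    transitive e -> {mono f : x y / e x y} ->
  sorted e (t :: map f s) = sorted e s && all (fun x => e t (f x)) s.
Proof.
move=> tr f_mono; rewrite !(sorted_pairwise tr) /= all_map pairwise_map andbC.
by congr (_ && _); apply: eq_pairwise => x y /=; rewrite f_mono.
Qed.

Lemma ext_right_chain (e : rel nat) q t w (p : pred nat) :
    transitive e -> {mono shift t : x y / e x y} ->
    (forall x, e (shift t x) t = p x) ->
    ~ has_chain e q.+1 predT w ->
  has_chain e q.+1 predT (ext_right t w) <-> has_chain e q p w.
Proof.
move=> tr mono pE no; rewrite /ext_right -cats1.
have := pivot_chain e (shift t) q t w [::] mono; rewrite cats0 => /(_ no) ->.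
split=> [[su [sv [suw]]]|[s [sw sz s_e s_p]]].
  rewrite subseq0 => /eqP -> /=; rewrite addn0 => sz.
  rewrite sorted_rcons_map // => /andP[s_e s_p]; exists su; split=> //.
  by apply: sub_all s_p => x; rewrite pE.
exists s, [::]; rewrite sub0seq addn0; split=> //.
rewrite sorted_rcons_map // s_e; apply: sub_all s_p => x; by rewrite pE.
Qed.

Lemma ext_left_chain (e : rel nat) q t w (p : pred nat) :
    transitive e -> {mono shift t : x y / e x y} ->
    (forall x, e t (shift t x) = p x) ->
    ~ has_chain e q.+1 predT w ->
  has_chain e q.+1 predT (ext_left t w) <-> has_chain e q p w.
Proof.
move=> tr mono pE no; rewrite /ext_left.
have -> := pivot_chain e (shift t) q t [::] w mono no.
split=> [[su [sv []]]|[s [sw sz s_e s_p]]].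
  rewrite subseq0 => /eqP -> svw /= sz.
  rewrite -[path _ _ _]/(sorted e (t :: _)) sorted_cons_map // => /andP[s_e s_p].
  by exists sv; split=> //; apply: sub_all s_p => x; rewrite pE.
exists [::], s; split=> //=.
rewrite -[path _ _ _]/(sorted e (t :: _)) sorted_cons_map // s_e.
by apply: sub_all s_p => x; rewrite pE.
Qed.

(** The new letter is larger than all others, so it can only be the last letter
    of an increasing chain. *)
Lemma ext_above_inc q t w :
    all (geq (size w)) w -> ~ has_chain ltn q.+1 predT w ->
  has_chain ltn q.+1 predT (ext_above t w) <-> has_chain ltn q predT (take t.-1 w).
Proof.
move=> w_le no; rewrite /ext_above -{1}[take _ w]map_id -{1}[drop _ w]map_id.
rewrite pivot_chain ?cat_take_drop //; split.
  case=> su [[|x sv] [suw svw sz s_lt]].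
    exists su; split=> //; first by rewrite -sz addn0.
    - by move: s_lt; rewrite !map_id; apply: (subseq_sorted ltn_trans);
        exact: prefix_subseq.
    - exact: all_predT.
  move: s_lt; rewrite !map_id (sorted_pairwise ltn_trans) pairwise_cat /=.
  case/and3P=> _ _ /andP[/andP[lt_x _] _].
  have /(allP w_le) /= : x \in w by apply: mem_drop; apply: (mem_subseq svw);
    exact: mem_head.
  by rewrite leqNgt (ltn_trans (ltnSn _) lt_x).
case=> s [sw sz s_lt _]; exists s, [::]; rewrite sub0seq addn0 !map_id; split=> //.
rewrite -[s]map_id sorted_rcons_map //; last exact: ltn_trans.
rewrite s_lt /=; apply/allP => x /(mem_subseq sw)/mem_take xw.
by have /= := allP w_le x xw; rewrite ltnS.
Qed.

Lemma ext_above_dec q t w :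
    all (geq (size w)) w -> ~ has_chain gtn q.+1 predT w ->
  has_chain gtn q.+1 predT (ext_above t w) <-> has_chain gtn q predT (drop t.-1 w).
Proof.
move=> w_le no; rewrite /ext_above -{1}[take _ w]map_id -{1}[drop _ w]map_id.
rewrite pivot_chain ?cat_take_drop //; split.
  case=> [[|x su] [sv [suw svw sz s_gt]]].
    exists sv; split=> //; last exact: all_predT.
    by move: s_gt; rewrite !map_id; exact: path_sorted.
  move: s_gt; rewrite !map_id (sorted_pairwise gtn_trans) pairwise_cat allrel_consr /=.
  case/and3P=> /andP[/andP[lt_x _] _] _ _.
  have /(allP w_le) /= : x \in w by apply: mem_take; apply: (mem_subseq suw);
    exact: mem_head.
  by rewrite leqNgt (ltn_trans (ltnSn _) lt_x).
case=> s [sw sz s_gt _]; exists [::], s; rewrite sub0seq !map_id; split=> //=.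
rewrite -[path _ _ _]/(sorted gtn (_ :: s)) -[s]map_id sorted_cons_map //;
  last exact: gtn_trans.
rewrite s_gt /=; apply/allP => x /(mem_subseq sw)/mem_drop xw.
by have /= := allP w_le x xw; rewrite ltnS.
Qed.

(** * Reading the criterion off the pair of tableaux *)

Lemma squeezes_has_chain (e : rel nat) u v q (p : pred nat) :
    (forall a b z, a <= z <= b -> p a -> p b -> p z) ->
  squeezes e u v -> has_chain e q p u -> has_chain e q p v.
Proof.
move=> p_convex uv [s [su sz s_e s_p]]; have [s' [s'v sz' s'_e hull]] := uv s su s_e.
exists s'; split; rewrite ?sz' //; apply/allP => z /hull[[a as_ az] [b bs zb]].
by apply: (p_convex a b); rewrite ?az ?zb //; apply: (allP s_p).
Qed.

Lemma same_chains_insertion w :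
  uniq w -> same_chains w (reading (foldl ins [::] w)).
Proof. exact: (foldl_ins_same_chains [::] w isT). Qed.

Lemma inc_chain_reading q (p : pred nat) w :
    uniq w -> (forall a b z, a <= z <= b -> p a -> p b -> p z) ->
  has_chain ltn q p w <-> has_chain ltn q p (reading (foldl ins [::] w)).
Proof.
by move=> /same_chains_insertion[wP Pw _ _] p_convex; split; exact: squeezes_has_chain.
Qed.

Lemma dec_chain_reading q (p : pred nat) w :
    uniq w -> (forall a b z, a <= z <= b -> p a -> p b -> p z) ->
  has_chain gtn q p w <-> has_chain gtn q p (reading (foldl ins [::] w)).
Proof.
by move=> /same_chains_insertion[_ _ wP Pw] p_convex; split; exact: squeezes_has_chain.
Qed.

Lemma tableau_insertion w : is_tableau (foldl ins [::] w).
Proof. exact: foldl_ins_tableau. Qed.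

Lemma uniq_insertion w : uniq w -> uniq (flatten (foldl ins [::] w)).
Proof. by rewrite (perm_uniq (perm_foldl_ins [::] w)). Qed.

Lemma inc_length q w :
  uniq w -> has_chain ltn q predT w <-> q <= size (head [::] (foldl ins [::] w)).
Proof.
move=> w_u; have tabP := tableau_insertion w; rewrite inc_chain_reading //.
split=> [[s [sP <- s_lt _]]|qP]; first exact: inc_columns.
exists (take q (head [::] (foldl ins [::] w))); split.
- exact: subseq_trans (take_subseq _ _) (head_reading _).
- by rewrite size_takel.
- have [P_s _ _] := and3P tabP.
  by rewrite -nth0; apply: take_sorted; apply: nth_uniq_sorted => //;
    exact: uniq_insertion.
- exact: all_predT.
Qed.

Lemma dec_length q w :
  uniq w -> contains_dec q w <-> q <= size (foldl ins [::] w).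
Proof.
move=> w_u; split=> [|qP]; first exact: contains_dec_rows.
have tabP := tableau_insertion w; set P := foldl ins [::] w in qP tabP.
case: q qP => [_|q qP]; first by exists [::]; rewrite sub0seq.
have szP : size P = (size P).-1.+1 by case: (size P) qP.
have : has_chain gtn (size P) (gtn (entry P (size P) 1).+1) (reading P).
  by rewrite szP; apply/min_dec_head => //; exact: ltnSn.
rewrite -dec_chain_reading // => [[s [sw sz s_gt _]]|a b z /andP[_ zb] _ /=];
  last first.
  exact: leq_ltn_trans.
exists (take q.+1 s); split; first exact: subseq_trans (take_subseq _ _) sw.
  by rewrite size_takel // sz.
exact: take_sorted.
Qed.

Lemma gains_take w j : gains [::] (take j w) = take j (gains [::] w).
Proof.
have [jw|wj] := leqP j (size w); last by rewrite !take_oversize ?size_gains // ltnW.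
rewrite -{2}(cat_take_drop j w) gains_cat take_size_cat // size_gains size_takel //.
Qed.

Lemma size_head_insertion w :
  size (head [::] (foldl ins [::] w)) = count_mem 0 (gains [::] w).
Proof. by rewrite -nth0 size_row_foldl_ins. Qed.

Lemma last_occurrence (x : nat) s :
  x \in s -> exists s1 s2, s = s1 ++ x :: s2 /\ x \notin s2.
Proof.
elim: s => [//|y s IH]; have [xs _|xs] := boolP (x \in s).
  by have [s1 [s2 [-> ?]]] := IH xs; exists (y :: s1), s2.
by rewrite in_cons (negPf xs) orbF => /eqP <-; exists [::], s.
Qed.

(** Let m be the length of g1. The first row reaches its final length at step
    m + 1, so a prefix of w contains a longest increasing chain if and only if it
    has more than m letters. Hence t = m + 1 is the last position at which a
    decreasing chain has to follow. *)
Lemma above_criterion w g1 g2 (P := foldl ins [::] w) :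
    uniq w -> gains [::] w = g1 ++ 0 :: g2 -> 0 \notin g2 ->
  (forall t, 1 <= t <= (size w).+1 ->
     has_chain ltn (size (head [::] P)) predT (take t.-1 w) \/
     has_chain gtn (size P) predT (drop t.-1 w)) <->
  subseq (iota 0 (size P)) (0 :: g2).
Proof.
move=> w_u gE g2_0; set m := size g1.
have mw : m < size w by rewrite -(size_gains [::]) gE size_cat /= -addSnnS leq_addr.
have inc_take j : has_chain ltn (size (head [::] P)) predT (take j w) <-> m < j.
  rewrite inc_length ?take_uniq // !size_head_insertion gains_take gE take_cat.
  rewrite !count_cat /= (count_memPn g2_0) addn0 -/m.
  case: ltngtP => [jm|mj|->].
  - have := leq_count_subseq (pred1 0) (take_subseq g1 j); rewrite addn1 /=;
      split=> //; lia.
  - by have -> : j - m = (j - m).-1.+1 by [lia]; rewrite count_cat /= leq_add2l.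
  - by rewrite subnn take0 cats0 addn1 ltnn.
have dec_drop : has_chain gtn (size P) predT (drop m w) <->
  subseq (iota 0 (size P)) (0 :: g2).
  have T_s : all (sorted leq) (foldl ins [::] (take m w)).
    by case/and3P: (tableau_insertion (take m w)).
  have PE : foldl ins (foldl ins [::] (take m w)) (drop m w) = P.
    by rewrite -foldl_cat cat_take_drop.
  have gainsE : gains (foldl ins [::] (take m w)) (drop m w) = 0 :: g2.
    have := gE; rewrite -{1}(cat_take_drop m w) gains_cat gains_take gE take_size_cat //.
    by move/eqP; rewrite eqseq_cat // eqxx => /eqP.
  rewrite has_chainT -gainsE; split; last exact: gains_contains_dec.
  by move=> dec; apply: contains_dec_gains => //; rewrite PE.
rewrite -dec_drop; split=> [hit|dec t _].
  by have [/inc_take|//] := hit m.+1 (ltnW mw); rewrite ltnn.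
have [tm|mt] := leqP t.-1 m; last by left; apply/inc_take.
right; case: dec => s [sw sz s_gt s_p]; exists s; split=> //.
apply: subseq_trans sw _; rewrite -{1}(subnK tm) -drop_drop; exact: drop_subseq.
Qed.

(** Row i of Q lists the steps t at which row i gains a cell, so an increasing
    sequence with one entry in each row amounts to a subsequence 0, 1, ... of g.
    The last entry of the first row is the position of the last 0 in g. *)
Lemma recording_criterion g g1 g2 K L
    (Q := foldl record [::] (zip (iota 1 (size g)) g)) :
    g = g1 ++ 0 :: g2 -> 0 \notin g2 -> K = count_mem 0 g -> size Q = L.+1 ->
  (exists j' : nat -> nat,
    [/\ j' 1 = K,
        forall i, 1 <= i <= L.+1 -> is_cell Q i (j' i) &
        forall i, 1 <= i < L.+1 -> entry Q i (j' i) < entry Q i.+1 (j' i.+1)]) <->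
  subseq (iota 0 L.+1) (0 :: g2).
Proof.
move=> gE g2_0 KE szQ; set m := size g1.
have rowE i : nth [::] Q i = [seq t <- iota 1 (size g) | nth 0 g t.-1 == i].
  exact: row_record.
have mem_row t i : (t \in nth [::] Q i) = (1 <= t <= size g) && (nth 0 g t.-1 == i).
  by rewrite rowE mem_filter mem_iota add1n ltnS andbC.
have K_gt0 : 0 < K by rewrite KE gE count_cat /= addnCA.
have szK : size (nth [::] Q 0) = K.
  rewrite KE row_foldl_record nth_nil /= size_map size_filter.
  rewrite -(count_map snd (pred1 0)) -/(unzip2 _) unzip2_zip // size_iota //.
(* The last 0 of g sits at index m, that is at step m + 1. *)
have entryK : entry Q 1 K = m.+1.
  rewrite /entry /= -szK nth_last rowE gE size_cat iotaD filter_cat /= add1n.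
  rewrite nth_cat ltnn subnn eqxx last_cat /= (eq_in_filter (a2 := pred0)).
    by rewrite filter_pred0.
  move=> t; rewrite mem_iota => /andP[mt tg] /=; apply: contraNF g2_0.
  rewrite nth_cat; case: ltnP => [|_]; first by rewrite /m in mt; lia.
  have -> : t.-1 - size g1 = (t.-1 - size g1).-1.+1 by rewrite /m in mt; lia.
  move=> /= /eqP t0; rewrite -[X in X \in _]t0; apply: mem_nth.
  move: mt tg; rewrite /m; move: (size g1) (size g2) => a b; clear; lia.
have dropE : drop m g = 0 :: g2 by rewrite gE drop_size_cat.
split=> [[j [j1 cell_j lt_j]]|].
  pose ts := mkseq (fun i => entry Q i.+1 (j i.+1)) L.+1.
  have ts_lt : sorted ltn ts.
    apply/(sortedP 0) => i; rewrite size_mkseq => iL.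
    by rewrite !nth_mkseq ?(ltnW iL) //; exact: lt_j.
  have ts_row i : i < L.+1 -> nth 0 ts i \in nth [::] Q i.
    move=> iL; rewrite nth_mkseq // /entry /=.
    have /and3P[_ /= jq jQ] := cell_j i.+1 iL.
    by apply: mem_nth; case: (j i.+1) jq jQ.
  have ts_le : sorted leq ts by apply: sub_sorted ts_lt => x y; exact: ltnW.
  have m_ts i : i < L.+1 -> m < nth 0 ts i.
    move=> iL; have <- : nth 0 ts 0 = m.+1 by rewrite nth_mkseq //= j1.
    by apply: (sorted_leq_nth leq_trans leqnn 0 ts_le); rewrite ?inE ?size_mkseq.
  have -> : iota 0 L.+1 = [seq nth 0 (0 :: g2) i | i <- [seq t - m.+1 | t <- ts]].
    apply: (@eq_from_nth _ 0) => [|i]; first by rewrite !size_map !size_iota.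
    rewrite size_iota => iL;
      rewrite nth_iota // add0n -map_comp (nth_map 0) ?size_mkseq //=.
    have := ts_row i iL; rewrite mem_row => /andP[_ /eqP {1}<-].
    rewrite -dropE nth_drop; have := m_ts i iL.
    by move: (nth 0 ts i) (m) => t a a_t; congr (nth 0 g _); lia.
  apply: index_subseq.
    rewrite sorted_map; apply: (sub_in_sorted (P := [pred t | m < t])) ts_lt.
      by move=> a b ma _ ab; exact: ltn_sub2r (leq_ltn_trans ma ab) ab.
    by apply/(all_nthP 0) => i; rewrite size_mkseq; exact: m_ts.
  rewrite all_map; apply/(all_nthP 0) => i; rewrite size_mkseq => iL.
  have := ts_row i iL; rewrite mem_row => /andP[/andP[_ tg] _].
  move: tg (m_ts i iL); rewrite gE size_cat -/m /=.
  by move: (nth 0 ts i) (size g2) (m) => t b a; clear; lia.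
case/subseq_index=> c [c_lt c_g cE].
have szc : size c = L.+1 by rewrite -(size_map (nth 0 (0 :: g2))) -cE size_iota.
pose tm i := (nth 0 c i.-1 + m).+1.
have tm_row i : 1 <= i <= L.+1 -> tm i \in nth [::] Q i.-1.
  case: i => //= i iL; rewrite mem_row /tm /=; apply/andP; split.
    have ic : i < size c by rewrite szc.
    have := allP c_g _ (mem_nth 0 ic); rewrite gE size_cat /= -/m.
    by move: (nth 0 c i) (size g2) (m) => t b a; clear; lia.
  have : nth 0 (iota 0 L.+1) i = i by rewrite nth_iota.
  by rewrite cE (nth_map 0) ?szc // -dropE nth_drop addnC => ->.
(* In row 1 the corner cell is forced; its entry m + 1 is at most tm 1. *)
pose j i := if i == 1 then K else (index (tm i) (nth [::] Q i.-1)).+1.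
have entry_j i : 1 < i <= L.+1 -> entry Q i (j i) = tm i.
  case/andP=> i1 iL; rewrite /entry /j gtn_eqF //= nth_index // tm_row // iL.
  by rewrite ltnW.
exists j; split=> // i.
  case/andP=> i1 iL; rewrite /is_cell szQ i1 iL /= /j.
  case: eqP => [->|_] /=; first by rewrite szK K_gt0 leqnn.
  by rewrite index_mem tm_row // i1.
case/andP=> i1 iL; rewrite (entry_j i.+1) ?ltnS ?i1 //.
have lt_tm : tm i < tm i.+1.
  case: i i1 iL => //= i _ iL; rewrite /tm /= ltnS ltn_add2r.
  by apply: (sorted_ltn_nth ltn_trans 0 c_lt) => //; rewrite inE szc // ltnW.
have [i1E|ne1] := eqVneq i 1; last first.
  by rewrite entry_j // (ltnW iL) andbT ltn_neqAle eq_sym ne1.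
apply: leq_ltn_trans lt_tm; rewrite i1E (_ : j 1 = K) // entryK.
by rewrite /tm ltnS leq_addl.
Qed.

Lemma mem_entry T i j : is_cell T i j -> entry T i j \in flatten T.
Proof.
case/andP=> /andP[i1 iT] /andP[j1 jT]; apply/flattenP; exists (nth [::] T i.-1).
  by apply: mem_nth; rewrite prednK.
by apply: mem_nth; rewrite prednK.
Qed.

Lemma mem_one_line n (sigma : 'S_n) x : x \in one_line sigma -> 1 <= x <= n.
Proof. by case/mapP=> i _ ->; exact: ltn_ord. Qed.

Lemma size_one_line n (sigma : 'S_n) : size (one_line sigma) = n.
Proof. by rewrite size_map size_enum_ord. Qed.

Lemma uniq_one_line n (sigma : 'S_n) : uniq (one_line sigma).
Proof.
rewrite map_inj_uniq ?enum_uniq // => i j [] /val_inj; exact: perm_inj.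
Qed.

Lemma contains_incE q w : contains_inc q w <-> has_chain ltn q predT w.
Proof. by rewrite has_chainT. Qed.

Lemma contains_decE q w : contains_dec q w <-> has_chain gtn q predT w.
Proof. by rewrite has_chainT. Qed.

Lemma shift_lt t x : (shift t x < t) = (x < t).
Proof. by rewrite /shift; case: (ltnP x t) => // tx; rewrite ltnNge leqW. Qed.

Lemma lt_shift t x : (t < shift t x) = (t <= x).
Proof. by rewrite /shift; case: (ltnP x t) => // xt; rewrite ltnNge ltnW. Qed.

Lemma hit_right K L t w :
    ~ contains_inc K.+1 w -> ~ contains_dec L.+1 w ->
  contains_inc K.+1 (ext_right t w) \/ contains_dec L.+1 (ext_right t w) <->
  has_chain ltn K (gtn t) w \/ has_chain gtn L (leq t) w.
Proof.
rewrite !contains_incE !contains_decE => no_inc no_dec.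
rewrite (ext_right_chain _ _ _ _ _ ltn_trans (shift_ltn t) (shift_lt t) no_inc).
by rewrite (ext_right_chain _ _ _ _ _ gtn_trans (shift_gtn t) (lt_shift t) no_dec).
Qed.

Lemma hit_left K L t w :
    ~ contains_inc K.+1 w -> ~ contains_dec L.+1 w ->
  contains_inc K.+1 (ext_left t w) \/ contains_dec L.+1 (ext_left t w) <->
  has_chain ltn K (leq t) w \/ has_chain gtn L (gtn t) w.
Proof.
rewrite !contains_incE !contains_decE => no_inc no_dec.
rewrite (ext_left_chain _ _ _ _ _ ltn_trans (shift_ltn t) (lt_shift t) no_inc).
by rewrite (ext_left_chain _ _ _ _ _ gtn_trans (shift_gtn t) (shift_lt t) no_dec).
Qed.

Lemma hit_above K L t w :
    all (geq (size w)) w -> ~ contains_inc K.+1 w -> ~ contains_dec L.+1 w ->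
  contains_inc K.+1 (ext_above t w) \/ contains_dec L.+1 (ext_above t w) <->
  has_chain ltn K predT (take t.-1 w) \/ has_chain gtn L predT (drop t.-1 w).
Proof.
move=> w_le; rewrite !contains_incE !contains_decE => no_inc no_dec.
by rewrite ext_above_inc // ext_above_dec.
Qed.

(** The extreme letters t = n + 1 and t = 1 on the right can only prolong an
    increasing chain and a decreasing chain respectively, so chains of both
    lengths K and L exist. *)
Lemma tricrucial_shape K L n (sigma : 'S_n) (P := foldl ins [::] (one_line sigma)) :
    0 < n -> tricrucial K.+1 L.+1 sigma ->
  [/\ 0 < K, 0 < L, size (head [::] P) = K & size P = L].
Proof.
rewrite /tricrucial; set w := one_line sigma => n_gt0 [no_inc no_dec hit].
have w_u : uniq w by exact: uniq_one_line.
have wP x : x \in w -> 1 <= x <= n by exact: mem_one_line.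
have P_K : size (head [::] P) <= K.
  rewrite leqNgt; apply/negP => K_P; apply: no_inc.
  by rewrite contains_incE; apply/inc_length.
have P_L : size P <= L.
  by rewrite leqNgt; apply/negP => L_P; apply: no_dec; apply/dec_length.
have w_gt0 : 0 < size w by rewrite size_one_line.
have L_gt0 : 0 < L.
  rewrite lt0n; apply: contra_notN no_dec => /eqP ->.
  by exists [:: nth 0 w 0]; rewrite sub1seq mem_nth.
have K_gt0 : 0 < K.
  rewrite lt0n; apply: contra_notN no_inc => /eqP ->.
  by exists [:: nth 0 w 0]; rewrite sub1seq mem_nth.
split=> //; apply/eqP; rewrite eqn_leq ?P_K ?P_L /=.
  have [|/hit_right[|||] // [s [sw sz s_lt s_n]] _ _] := hit n.+1;
    first by rewrite ltnSn.
    apply/inc_length => //; exists s; split=> //; exact: all_predT.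
  case: s sw sz s_lt s_n => [|x s] sw sz _; first by rewrite -sz in L_gt0.
  by move=> /= /andP[nx _]; have /wP/andP[_] := mem_subseq sw (mem_head x s);
    rewrite leqNgt nx.
have [|/hit_right[|||] // [s [sw sz s_lt s_1]] _ _] := hit 1; first by [].
  case: s sw sz s_lt s_1 => [|x s] sw sz _; first by rewrite -sz in K_gt0.
  move=> /= /andP[x0 _]; have /wP/andP[x1 _] := mem_subseq sw (mem_head x s).
  by case: x x0 x1 {sw sz}.
by apply: contains_dec_rows => //; exists s.
Qed.

Lemma ge_convex t a b z : a <= z <= b -> t <= a -> t <= b -> t <= z.
Proof. by case/andP=> az _ ta _; exact: leq_trans az. Qed.

Lemma lt_convex t a b z : a <= z <= b -> a < t -> b < t -> z < t.
Proof. by case/andP=> _ zb _; exact: leq_ltn_trans. Qed.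

(** The letter t = p_{1,K} is the largest that does not prolong an increasing
    chain, so it decides the condition for all t. A decreasing chain whose end is
    at least p_{1,K} yields the sequence starting at the corner cell, once its
    entry in the first row is replaced by p_{1,K}. *)
Lemma right_criterion w (P := foldl ins [::] w) K L :
    uniq w -> (forall x, x \in w -> 1 <= x <= size w) ->
    0 < K -> 0 < L -> size (head [::] P) = K -> size P = L ->
  (forall t, 1 <= t <= (size w).+1 -> has_chain ltn K (gtn t) w \/ has_chain gtn L (leq t) w) <->
  exists j : nat -> nat,
    [/\ j 1 = K, forall i, 1 <= i <= L -> is_cell P i (j i) &
        forall i, 1 <= i < L -> entry P i (j i) < entry P i.+1 (j i.+1)].
Proof.
move=> w_u w_le K_gt0 L_gt0 szK szL.
have tabP : is_tableau P by exact: tableau_insertion.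
have P_u : uniq (flatten P) by exact: uniq_insertion.
have cellK : is_cell P 1 K by rewrite /is_cell szL L_gt0 K_gt0 /= nth0 szK.
have incE t : has_chain ltn K (gtn t) w <-> entry P 1 K < t.
  rewrite (inc_chain_reading _ (gtn t)) //; last exact: lt_convex.
  case: K K_gt0 szK {cellK} => // q _ szq; rewrite min_inc_end // szq.
  by split=> [[]|].
have decE t : has_chain gtn L (leq t) w <-> exists j : nat -> nat,
    [/\ t <= entry P 1 (j 1), forall i, 1 <= i <= L -> is_cell P i (j i) &
        forall i, 1 <= i < L -> entry P i (j i) < entry P i.+1 (j i.+1)].
  rewrite (dec_chain_reading _ (leq t)) //; last exact: ge_convex.
  by rewrite -szL max_dec_end // szL.
split=> [hit|[j [j1 cell_j lt_j]] t _].
  have entry_w : 1 <= entry P 1 K <= size w.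
    by apply: w_le; rewrite -(perm_mem (perm_foldl_ins [::] w)) mem_entry.
  have /andP[e1 ew] := entry_w.
  have [|/incE|/decE[j [K_j cell_j lt_j]]] := hit (entry P 1 K); rewrite ?ltnn //.
    by rewrite e1 ltnW.
  exists (fun i => if i == 1 then K else j i); split=> // [i|i /andP[i1 iL]].
    by case: eqP => [->|_] //; exact: cell_j.
  have lt_i := lt_j i (introT andP (conj i1 iL));
    rewrite [i.+1 == 1](gtn_eqF (i1 : 1 < i.+1)).
  by case: eqP lt_i => [-> lt_i|//]; exact: leq_ltn_trans lt_i.
have [lt_t|t_le] := ltnP (entry P 1 K) t; [left; exact/incE | right].
by apply/decE; exists j; rewrite j1.
Qed.

(** Here the deciding letter is p_{L,1}, the smallest head of a decreasing chain
    with L letters. *)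
Lemma left_criterion w (P := foldl ins [::] w) K L :
    uniq w -> (forall x, x \in w -> 1 <= x <= size w) ->
    0 < K -> 0 < L -> size (head [::] P) = K -> size P = L ->
  (forall t, 1 <= t <= (size w).+1 -> has_chain ltn K (leq t) w \/ has_chain gtn L (gtn t) w) <->
  exists i : nat -> nat,
    [/\ i 1 = L, forall j, 1 <= j <= K -> is_cell P (i j) j &
        forall j, 1 <= j < K -> entry P (i j) j < entry P (i j.+1) j.+1].
Proof.
move=> w_u w_le K_gt0 L_gt0 szK szL.
have tabP : is_tableau P by exact: tableau_insertion.
have P_u : uniq (flatten P) by exact: uniq_insertion.
have cellL : is_cell P L 1.
  rewrite /is_cell szL L_gt0 leqnn /= lt0n size_eq0.
  have [_ P_n _] := and3P tabP; apply: contraNneq P_n => <-.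
  by apply: mem_nth; rewrite szL prednK.
have decE t : has_chain gtn L (gtn t) w <-> entry P L 1 < t.
  rewrite (dec_chain_reading _ (gtn t)) //; last exact: lt_convex.
  by case: L L_gt0 szL {cellL} => // q _ szq; exact: min_dec_head.
have incE t : has_chain ltn K (leq t) w <-> exists i : nat -> nat,
    [/\ t <= entry P (i 1) 1, forall j, 1 <= j <= K -> is_cell P (i j) j &
        forall j, 1 <= j < K -> entry P (i j) j < entry P (i j.+1) j.+1].
  rewrite (inc_chain_reading _ (leq t)) //; last exact: ge_convex.
  by rewrite -szK max_inc_head // szK.
split=> [hit|[i [i1 cell_i lt_i]] t _].
  have entry_w : 1 <= entry P L 1 <= size w.
    by apply: w_le; rewrite -(perm_mem (perm_foldl_ins [::] w)) mem_entry.
  have /andP[e1 ew] := entry_w.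
  have [|/incE[i [L_i cell_i lt_i]]|/decE] := hit (entry P L 1); rewrite ?ltnn //.
    by rewrite e1 ltnW.
  exists (fun j => if j == 1 then L else i j); split=> // [j|j /andP[j1 jK]].
    by case: eqP => [->|_] //; exact: cell_i.
  have lt_j := lt_i j (introT andP (conj j1 jK));
    rewrite [j.+1 == 1](gtn_eqF (j1 : 1 < j.+1)).
  by case: eqP lt_j => [-> lt_j|//]; exact: leq_ltn_trans lt_j.
have [lt_t|t_le] := ltnP (entry P L 1) t; [right; exact/decE | left].
by apply/incE; exists i; rewrite i1.
Qed.

Lemma tricrucial_chains K L n (sigma : 'S_n) (w := one_line sigma) :
    ~ contains_inc K.+1 w -> ~ contains_dec L.+1 w ->
  tricrucial K.+1 L.+1 sigma <->
  [/\ forall t, 1 <= t <= (size w).+1 ->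
        has_chain ltn K (gtn t) w \/ has_chain gtn L (leq t) w,
      forall t, 1 <= t <= (size w).+1 ->
        has_chain ltn K (leq t) w \/ has_chain gtn L (gtn t) w &
      forall t, 1 <= t <= (size w).+1 ->
        has_chain ltn K predT (take t.-1 w) \/ has_chain gtn L predT (drop t.-1 w)].
Proof.
move=> no_inc no_dec; have szw : size w = n by exact: size_one_line.
have w_le : all (geq (size w)) w.
  by rewrite szw; apply/allP => x /mem_one_line/andP[].
rewrite /tricrucial -/w szw.
split=> [[_ _ hit]|[right left top]].
  split=> t /hit[hit_r hit_l hit_a].
  - by rewrite -hit_right.
  - by rewrite -hit_left.
  - by rewrite -hit_above.
split=> // t tw; split; first by rewrite hit_right //; exact: right.
  by rewrite hit_left //; exact: left.
by rewrite hit_above //; exact: top.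
Qed.

Theorem theorem31 (k l n : nat) (k_gt0 : 0 < k) (l_gt0 : 0 < l) (n_gt0 : 0 < n)
    (sigma : 'S_n) (P Q : tableau) (PQ_sigma : RSK sigma = (P, Q)) :
  tricrucial k l sigma <->
  [/\ (* (1) *) num_cols P = k - 1 /\ num_cols Q = k - 1,
      (* (2) *) num_rows P = l - 1 /\ num_rows Q = l - 1,
      (* (3) *) exists j : nat -> nat,
        [/\ j 1 = k - 1,
            forall i, 1 <= i <= l - 1 -> is_cell P i (j i) &
            forall i, 1 <= i < l - 1 ->
              entry P i (j i) < entry P i.+1 (j i.+1)],
      (* (4) *) exists i : nat -> nat,
        [/\ i 1 = l - 1,
            forall j, 1 <= j <= k - 1 -> is_cell P (i j) j &
            forall j, 1 <= j < k - 1 ->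
              entry P (i j) j < entry P (i j.+1) j.+1] &
      (* (5) *) exists j' : nat -> nat,
        [/\ j' 1 = k - 1,
            forall i, 1 <= i <= l - 1 -> is_cell Q i (j' i) &
            forall i, 1 <= i < l - 1 ->
              entry Q i (j' i) < entry Q i.+1 (j' i.+1)]].
Proof.
case: k k_gt0 => // K _; case: l l_gt0 => // L _; rewrite !subn1 !succnK.
have := RSKE n sigma; rewrite PQ_sigma; set w := one_line sigma.
cbv zeta; rewrite -(size_gains [::] w) => -[PE QE].
have szw : size w = n by exact: size_one_line.
have w_u : uniq w by exact: uniq_one_line.
have w_le x : x \in w -> 1 <= x <= size w by rewrite szw; exact: mem_one_line.
have tabP : is_tableau P by rewrite PE; exact: tableau_insertion.
have shapeQ : shape Q = shape P.
  by rewrite QE PE size_gains shape_foldl_record.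
have colsQ : num_cols Q = num_cols P by exact: shape_num_cols.
have rowsQ : size Q = size P by rewrite -!(size_map size) -/(shape _) shapeQ.
have w_gt0 : 0 < size w by rewrite szw.
have P_K : 0 < size (head [::] P).
  rewrite PE; apply/inc_length => //; apply/has_chainT.
  by exists [:: nth 0 w 0]; rewrite sub1seq mem_nth.
have P_L : 0 < size P by case: (P) P_K.
have shapeE : tricrucial K.+1 L.+1 sigma -> num_cols P = K /\ num_rows P = L.
  move/(tricrucial_shape K L n sigma n_gt0) => [_ _ szK szL].
  by rewrite num_colsE // /num_rows PE.
rewrite /num_rows colsQ rowsQ.
suff criterion : num_cols P = K -> size P = L ->
  (tricrucial K.+1 L.+1 sigma <-> 
   [/\ exists j : nat -> nat,
        [/\ j 1 = K,
            forall i, 1 <= i <= L -> is_cell P i (j i) &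
            forall i, 1 <= i < L ->
              entry P i (j i) < entry P i.+1 (j i.+1)],
       exists i : nat -> nat,
        [/\ i 1 = L,
            forall j, 1 <= j <= K -> is_cell P (i j) j &
            forall j, 1 <= j < K ->
              entry P (i j) j < entry P (i j.+1) j.+1] &
       exists j' : nat -> nat,
        [/\ j' 1 = K,
            forall i, 1 <= i <= L -> is_cell Q i (j' i) &
            forall i, 1 <= i < L ->
              entry Q i (j' i) < entry Q i.+1 (j' i.+1)]]).
  split=> [tri|[[szK _] [szL _] c3 c4 c5]]; last exact/criterion.
  by have [szK szL] := shapeE tri; have [] := (criterion szK szL).1 tri.
rewrite num_colsE // => szK szL.
have K_gt0 : 0 < K by rewrite -szK.
have L_gt0 : 0 < L by rewrite -szL.
have no_inc : ~ contains_inc K.+1 w.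
  by rewrite contains_incE inc_length // -PE szK ltnn.
have no_dec : ~ contains_dec L.+1 w.
  by rewrite dec_length // -PE szL ltnn.
have [g1 [g2 [gE g2_0]]] : exists g1 g2, gains [::] w = g1 ++ 0 :: g2 /\ 0 \notin g2.
  by apply: last_occurrence; rewrite -has_pred1 has_count -size_head_insertion -PE.
rewrite tricrucial_chains // -/w.
have c3 := right_criterion w K L w_u w_le K_gt0 L_gt0; rewrite -PE in c3.
have c4 := left_criterion w K L w_u w_le K_gt0 L_gt0; rewrite -PE in c4.
have c5 := above_criterion w g1 g2 w_u gE g2_0; rewrite -PE szK szL in c5.
case: L L_gt0 szL c3 c4 c5 {shapeE no_dec P_L} => // L _ szL c3 c4 c5.
have KE : K = count_mem 0 (gains [::] w) by rewrite -szK PE size_head_insertion.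
have := recording_criterion _ g1 g2 K L gE g2_0 KE; rewrite -QE rowsQ => /(_ szL) c6.
move: c3 c4 => /(_ szK szL) c3 /(_ szK szL) c4; split=> -[h3 h4 h5].
  by split; [exact: c3.1 | exact: c4.1 | exact: (c6.2 (c5.1 h5))].
by split; [exact: c3.2 | exact: c4.2 | exact: (c5.2 (c6.1 h5))].
Qed.
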